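(* Consider the linear time-invariant system $x_{t+1}=Ax_t+Bu_t+w_t$, $t\in\mathbb{N}$, with $x_t\in\mathbb{R}^n$, $u_t\in\mathbb{R}^m$, $x_0\sim\mathcal{N}(0,\Sigma_0)$ and i.i.d. noise $w_t\sim\mathcal{N}(0,\Sigma_w)$. Let $Q\in\mathbb{R}^{n\times n}$ be symmetric positive definite, and suppose $(A,B)$ is stabilizable, $(A,Q^{1/2})$ is detectable, and $B$ has full column rank. Let $\lambda>0$, $\gamma\in(0,1)$ and $$R_{\mathrm{FR}}=B^\top\Sigma_w^{-1}B,\qquad R_{\mathrm O}=B^\top B,\qquad R_{\mathrm{KW}}=B^\top(\Sigma_w+\lambda I)^{-1}B.$$ For each $\circ\in\{\mathrm{FR},\mathrm O,\mathrm{KW}\}$ let $P_\circ$ be the unique symmetric positive definite solution $P$ of the discrete algebraic Riccati equation $$A_\gamma^\top PA_\gamma-P+Q-A_\gamma^\top PB\,(B^\top PB+\tfrac1\gamma R_\circ)^{-1}B^\top PA_\gamma=0,\qquad A_\gamma=\sqrt\gamma\,A.$$ Then the optimal linear policy $u_t=Fx_t$ minimizing $$J^\circ(F)=\mathbb{E}\Big[\sum_{t=0}^\infty\gamma^t\Big(\tfrac12x_t^\top Qx_t+D^\circ(p_t\mid p_0)\Big)\Big]$$ is given by $$F_\circ=-\gamma\,(R_\circ+\gamma B^\top P_\circ B)^{-1}B^\top P_\circ A .$$ In particular, $F_{\mathrm O}$ does not depend on $\Sigma_w$. If $\Sigma_w=\rho I$ for some $\rho>0$ and $\lambda=1$, then: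 1. $\lim_{\rho\searrow0}F_{\mathrm{KW}}=F_{\mathrm O}$. 2. $\lim_{\rho\to\infty}\|F_{\mathrm{KW}}-F_{\mathrm{FR}}\|=0$. 3. Additionally, if the spectral radius of $A$ is less than $1/\sqrt\gamma$, then $\lim_{\rho\searrow0}F_{\mathrm{FR}}=0$, while $\lim_{\rho\searrow0}F_{\mathrm{KW}}=F_{\mathrm O}$ is not the zero policy in general (i.e. there are systems satisfying all these assumptions for which $F_{\mathrm O}\ne0$).
   Context: Here $p_t=p(x_{t+1}\mid x_t,u_t)=\mathcal{N}(Ax_t+Bu_t,\Sigma_w)$ and $p_0=p(x_{t+1}\mid x_t,u_t=0)=\mathcal{N}(Ax_t,\Sigma_w)$ are the controlled and uncontrolled conditional transition distributions, and $D^\circ$ are the Fisher–Rao (KL), Otto/Wasserstein (WKL) and Kalman–Wasserstein (KWKL, regularization parameter $\lambda$) divergences. For Gaussians with equal covariance they evaluate to $D^{\mathrm{FR}}(\mathcal{N}(a,\Sigma)\mid\mathcal{N}(b,\Sigma))=\frac12(a-b)^\top\Sigma^{-1}(a-b)$, $D^{\mathrm O}=\frac12\|a-b\|^2$, $D^{\mathrm{KW}}=\frac12(a-b)^\top(\Sigma+\lambda I)^{-1}(a-b)$, so that $D^\circ(p_t\mid p_0)=\frac12u_t^\top R_\circ u_t$. The policy class consists of linear feedbacks $u_t=Fx_t$, $F\in\mathbb{R}^{m\times n}$. $\Sigma_w$ is symmetric positive definite. $(A,B)$ is stabilizable if there is $F$ such that all eigenvalues of $A+BF$ lie in the open unit disc;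 $(A,Q^{1/2})$ is detectable if $(A^\top,(Q^{1/2})^\top)$ is stabilizable. *)

(* Defs.v *)
From HB Require Import structures.
From mathcomp Require Import all_boot all_order all_algebra.
From mathcomp Require Import complex.
From mathcomp Require Import all_classical all_reals all_analysis.

Set Implicit Arguments.
Unset Strict Implicit.
Unset Printing Implicit Defensive.

Import Order.TTheory GRing.Theory Num.Theory.
Import numFieldNormedType.Exports.

Local Open Scope classical_set_scope.
Local Open Scope ring_scope.

Section Matrices.
Context {R : realType}.

Definition quad n (M : 'M[R]_n) (v : 'cV[R]_n) : R := (v^T *m M *m v) 0 0.

Definition psd n (M : 'M[R]_n) : Prop :=
  M^T = M /\ forall v : 'cV[R]_n, 0 <= quad M v.

Definition spd n (M : 'M[R]_n) : Prop :=
  M^T = M /\ forall v : 'cV[R]_n, v != 0 -> 0 < quad M v.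

Definition sqrt_mx n (M : 'M[R]_n) : 'M[R]_n :=
  xget 0 [set S | psd S /\ S *m S = M].

(* [eigenvalue] only ranges over the base field, hence the complexification. *)
Definition complex_eigenvalue n (M : 'M[R]_n) (z : complex R) : Prop :=
  eigenvalue (map_mx (real_complex R) M) z.

Definition spectral_radius n (M : 'M[R]_n) : R :=
  sup [set ComplexField.Normc.normc z | z in complex_eigenvalue M].

Definition schur_stable n (M : 'M[R]_n) : Prop :=
  forall z : complex R, complex_eigenvalue M z -> ComplexField.Normc.normc z < 1.

Definition stabilizable n m (A : 'M[R]_n) (B : 'M[R]_(n, m)) : Prop :=
  exists F : 'M[R]_(m, n), schur_stable (A + B *m F).

Definition detectable n p (A : 'M[R]_n) (C : 'M[R]_(p, n)) : Prop :=
  stabilizable A^T C^T.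

Definition system_assumptions n m (A : 'M[R]_n) (B : 'M[R]_(n, m))
    (Q : 'M[R]_n) (gamma : R) : Prop :=
  [/\ spd Q, stabilizable A B, detectable A (sqrt_mx Q), \rank B = m
    & 0 < gamma < 1].

End Matrices.

Variant geometry := FR | Otto | KW.

Section Divergences.
Context {R : realType}.

(* The parameters of a Gaussian law N(gmean, gcov) on R^n. *)
Record gaussian n := Gaussian { gmean : 'cV[R]_n ; gcov : 'M[R]_n }.

(* The divergences D(p | q) between two Gaussians with the same covariance
   matrix; the value is meaningless when [gcov p <> gcov q].  The Otto case is
   half the squared Euclidean distance of the means (the norm [`| _ |] of the
   library is the sup norm). *)
Definition divergence (o : geometry) (lambda : R) n (p q : gaussian n) : R :=
  let d := gmean p - gmean q in
  match o with
  | FR => 2^-1 * quad (invmx (gcov p)) d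
  | Otto => 2^-1 * (d^T *m d) 0 0
  | KW => 2^-1 * quad (invmx (gcov p + lambda%:M)) d
  end.

Definition transition n m (A : 'M[R]_n) (B : 'M[R]_(n, m)) (Sigma_w : 'M[R]_n)
    (x : 'cV[R]_n) (u : 'cV[R]_m) : gaussian n :=
  Gaussian (A *m x + B *m u) Sigma_w.

End Divergences.

Section Riccati.
Context {R : realType}.
Variables (n m : nat) (A : 'M[R]_n) (B : 'M[R]_(n, m)).

Definition control_weight (o : geometry) (Sigma_w : 'M[R]_n) (lambda : R) :
    'M[R]_m :=
  match o with
  | FR => B^T *m invmx Sigma_w *m B
  | Otto => B^T *m B
  | KW => B^T *m invmx (Sigma_w + lambda%:M) *m B
  end.

Variables (Q : 'M[R]_n) (gamma : R).

Definition dare (Ro : 'M[R]_m) (P : 'M[R]_n) : Prop :=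
  let Ag := Num.sqrt gamma *: A in
  Ag^T *m P *m Ag - P + Q
    - Ag^T *m P *m B *m invmx (B^T *m P *m B + gamma^-1 *: Ro)
        *m B^T *m P *m Ag = 0.

Definition riccati (Ro : 'M[R]_m) : 'M[R]_n :=
  xget 0 [set P | spd P /\ dare Ro P].

Definition gain (o : geometry) (Sigma_w : 'M[R]_n) (lambda : R) : 'M[R]_(m, n) :=
  let Ro := control_weight o Sigma_w lambda in
  let P := riccati Ro in
  - gamma *: (invmx (Ro + gamma *: (B^T *m P *m B)) *m B^T *m P *m A).

End Riccati.

Section Randomness.
Context {R : realType} {d : measure_display} {Omega : measurableType d}.
Variable Pr : probability Omega R.

(* The law N(mu, v) on R, [v] being the variance; it is the Dirac mass at [mu]
   when [v = 0], a case in which [normal_prob] is not the degenerate normal. *)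
Definition normal_law (mu v : R) (V : set R) : \bar R :=
  if v == 0 then \d_mu V else normal_prob mu (Num.sqrt v) V.

Definition borel n (V : set 'cV[R]_n) : Prop := <<s @open 'cV[R]_n >> V.

Definition random_vector n (X : Omega -> 'cV[R]_n) : Prop :=
  forall V, borel V -> measurable (X @^-1` V).

(* X ~ N(mu, S): every linear functional of X is a scalar normal variable.
   This covers singular S. *)
Definition gaussian_vector n (X : Omega -> 'cV[R]_n) (mu : 'cV[R]_n)
    (S : 'M[R]_n) : Prop :=
  random_vector X /\
  forall (c : 'cV[R]_n) (V : set R), measurable V ->
    Pr [set om | V ((c^T *m X om) 0 0)]
    = normal_law ((c^T *m mu) 0 0) (quad S c) V.

Definition mutually_independent n (Z : nat -> Omega -> 'cV[R]_n) : Prop :=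
  forall (I : seq nat) (V : nat -> set 'cV[R]_n),
    uniq I -> (forall i, borel (V i)) ->
    Pr (\bigcap_(i in [set` I]) (Z i @^-1` V i))
    = (\prod_(i <- I) Pr (Z i @^-1` V i))%E.

(* The initial state is independent of the noise sequence. *)
Definition initial_and_noise n (x0 : Omega -> 'cV[R]_n)
    (w : nat -> Omega -> 'cV[R]_n) (Sigma_0 Sigma_w : 'M[R]_n) : Prop :=
  [/\ gaussian_vector x0 0 Sigma_0,
      forall t, gaussian_vector (w t) 0 Sigma_w
    & mutually_independent (fun i => if i is t.+1 then w t else x0)].

Fixpoint trajectory n m (A : 'M[R]_n) (B : 'M[R]_(n, m)) (F : 'M[R]_(m, n))
    (x0 : Omega -> 'cV[R]_n) (w : nat -> Omega -> 'cV[R]_n)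
    (t : nat) (om : Omega) : 'cV[R]_n :=
  if t is s.+1 then
    let x := trajectory A B F x0 w s om in A *m x + B *m (F *m x) + w s om
  else x0 om.

Definition cost (o : geometry) (lambda : R) n m (A : 'M[R]_n)
    (B : 'M[R]_(n, m)) (Q : 'M[R]_n) (gamma : R) (Sigma_w : 'M[R]_n)
    (x0 : Omega -> 'cV[R]_n) (w : nat -> Omega -> 'cV[R]_n)
    (F : 'M[R]_(m, n)) : \bar R :=
  (\int[Pr]_om \sum_(0 <= t <oo)
    (let x := trajectory A B F x0 w t om in
     gamma ^+ t *
       (2^-1 * quad Q x
        + divergence o lambda (transition A B Sigma_w x (F *m x))
                              (transition A B Sigma_w x 0)))%:E)%E.

End Randomness.

Definition unique_minimizer {R : realType} {T : Type} (J : T -> \bar R)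
    (F : T) : Prop :=
  forall G : T, G <> F -> (J F < J G)%E.

(* Main.v *)
Require Import Defs.
From HB Require Import structures.
From mathcomp Require Import all_boot all_order all_algebra.
From mathcomp Require Import complex ring lra.
From mathcomp Require Import all_classical all_reals all_analysis.
From mathcomp Require Import measurable_realfun.

Set Implicit Arguments.
Unset Strict Implicit.
Unset Printing Implicit Defensive.

Import Order.TTheory GRing.Theory Num.Theory.
Import numFieldNormedType.Exports.

Local Open Scope classical_set_scope.
Local Open Scope ring_scope.

(** The closed loop is compared with a positive definite solution P of the
    discounted Riccati equation by completing the square: for every state x and
    input u, the one-step cost satisfies
      x'Qx + u'Ru + gamma (Ax + Bu)'P(Ax + Bu) = x'Px + (u - Fx)'H(u - Fx),
    where H = R + gamma B'PB is positive definite and F is the gain of P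
    ([bellman_square]); a prime on a vector or a matrix denotes transposition.

    Optimality.  The noise is centred and uncorrelated with the state, so the
    second moments of the state under a feedback G obey a linear recursion and
    J(G) is half a series of traces ([costE]).  Taking expectations in the
    identity and telescoping,
      sum_(t < T) gamma^t E[x'Qx + u'Ru] + gamma^T E[x_T'P x_T]
    equals a quantity independent of G plus the nonnegative sum of
    gamma^t E[(u - Fx)'H(u - Fx)].  When J(G) is finite the boundary term
    vanishes in the limit because P is dominated by Q.  The excess is strictly
    positive for G <> F, because already at time 1 the state contains the
    nondegenerate noise w_0 ([gain_unique_minimizer]).

    Existence and uniqueness of P.  A quadratic form that is below its one-step
    Bellman inequality for every input lies below any form that is above it
    along one feedback ([bellman_comparison]); uniqueness is immediate.  Value
    iteration from 0 increases and stays below the value of a stabilizing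
    feedback, hence converges ([riccati_exists]).  That this value is finite is
    a Lyapunov estimate ([discounted_lyapunov]), which rests on a bound of the
    powers of a matrix by the moduli of its complex eigenvalues
    ([real_powers_bound]); that bound comes from the Cayley-Hamilton theorem.

    Limits.  For Sigma_w = rho I and lambda = 1 the Fisher-Rao,
    Kalman-Wasserstein and Otto weights are multiples s B'B, with s = 1/rho,
    1/(rho + 1) and 1 respectively.  Let P_s be the corresponding
    solutions.  Comparison gives P_s <= P_r <= (r/s) P_s for s <= r, because
    multiplying all costs by r/s multiplies the value by r/s.  Hence the gains
    differ by O(1 - s/r) uniformly for s <= r <= 1 ([gain_lipschitz]).  With
    r = 1 and s = 1/(rho + 1) this is the limit rho -> 0 of the
    Kalman-Wasserstein gain; with r = 1/rho and s = 1/(rho + 1) it bounds the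
    distance between the Kalman-Wasserstein and Fisher-Rao gains by
    O(1/(rho + 1)).  If the zero policy has finite cost then P_s stays bounded
    as s tends to infinity, while H grows like s, so that the Fisher-Rao gain is
    O(1/s) = O(rho) ([gain_decay]).  The Otto gain of the scalar system
    A = 1/2, B = Q = 1, gamma = 1/2 is not zero, because a zero gain forces
    B'PA = 0 ([half_gain_neq0]). *)

(** * Quadratic forms and positive definite matrices *)

Section QuadraticForms.
Context {R : realType}.

Definition bilin n (M : 'M[R]_n) (u v : 'cV[R]_n) : R := (u^T *m M *m v) 0 0.

Definition sqnorm n (v : 'cV[R]_n) : R := (v^T *m v) 0 0.

(** The form as a combination of the products [v i 0 * v j 0]: in this shape
    expectations can be taken term by term. *)
Lemma quadE n (M : 'M[R]_n) (v : 'cV[R]_n) :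
  quad M v = \sum_i \sum_j M i j * (v i 0 * v j 0).
Proof.
rewrite /quad !mxE exchange_big /=; apply: eq_bigr => j _.
rewrite !mxE big_distrl /=; apply: eq_bigr => i _; rewrite !mxE; ring.
Qed.

Lemma sqnormE n (v : 'cV[R]_n) : sqnorm v = \sum_i v i 0 ^+ 2.
Proof. by rewrite /sqnorm mxE; apply: eq_bigr => i _; rewrite mxE expr2. Qed.

Lemma quad_sqnorm n (v : 'cV[R]_n) : quad 1%:M v = sqnorm v.
Proof. by rewrite /quad mulmx1. Qed.

Lemma sqnorm_ge0 n (v : 'cV[R]_n) : 0 <= sqnorm v.
Proof. by rewrite sqnormE sumr_ge0 // => i _; rewrite sqr_ge0. Qed.

Lemma coord_sqnorm n (v : 'cV[R]_n) i : v i 0 ^+ 2 <= sqnorm v.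
Proof.
by rewrite sqnormE (bigD1 i) //= lerDl sumr_ge0 // => j _; rewrite sqr_ge0.
Qed.

Lemma sqnorm_gt0 n (v : 'cV[R]_n) : v != 0 -> 0 < sqnorm v.
Proof.
move=> v0; rewrite lt_def sqnorm_ge0 andbT; apply: contraNneq v0 => s0.
apply/eqP/matrixP => i j; rewrite ord1 mxE; apply/eqP.
by rewrite -sqrf_eq0 eq_le sqr_ge0 andbT -s0 coord_sqnorm.
Qed.

Lemma quadD n (M N : 'M[R]_n) v : quad (M + N) v = quad M v + quad N v.
Proof. by rewrite /quad mulmxDr mulmxDl mxE. Qed.

Lemma quadN n (M : 'M[R]_n) v : quad (- M) v = - quad M v.
Proof. by rewrite /quad mulmxN mulNmx mxE. Qed.

Lemma quadZ n a (M : 'M[R]_n) v : quad (a *: M) v = a * quad M v.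
Proof. by rewrite /quad -scalemxAr -scalemxAl mxE. Qed.

Lemma quad0 n (v : 'cV[R]_n) : quad 0 v = 0.
Proof. by rewrite /quad mulmx0 mul0mx mxE. Qed.

Lemma quadv0 n (M : 'M[R]_n) : quad M 0 = 0.
Proof. by rewrite /quad mulmx0 mxE. Qed.

Lemma quad_congr n p (M : 'M[R]_n) (F : 'M[R]_(n, p)) v :
  quad (F^T *m M *m F) v = quad M (F *m v).
Proof. by rewrite /quad trmx_mul !mulmxA. Qed.

Lemma quad_sum n (I : Type) (r : seq I) (P : pred I) (M : I -> 'M[R]_n) v :
  quad (\sum_(i <- r | P i) M i) v = \sum_(i <- r | P i) quad (M i) v.
Proof. by apply: (big_morph (fun N => quad N v)) => [x y|]; rewrite (quadD, quad0). Qed.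

Lemma bilinC n (M : 'M[R]_n) u v : M^T = M -> bilin M u v = bilin M v u.
Proof.
move=> symM; rewrite /bilin.
have -> : ((u^T *m M *m v) 0 0) = ((u^T *m M *m v)^T) 0 0 by rewrite [RHS]mxE.
by rewrite !trmx_mul trmxK symM mulmxA.
Qed.

Lemma quad_add n (M : 'M[R]_n) u v : M^T = M ->
  quad M (u + v) = quad M u + 2 * bilin M u v + quad M v.
Proof.
move=> symM; have -> : quad M (u + v)
   = quad M u + bilin M u v + bilin M v u + quad M v.
  rewrite /quad /bilin [(u + v)^T]linearD /= !mulmxDl !mulmxDr !mxE; ring.
rewrite (bilinC v u symM); ring.
Qed.

Lemma quad_scale n (M : 'M[R]_n) a v : quad M (a *: v) = a ^+ 2 * quad M v.
Proof.
rewrite /quad [(a *: v)^T]linearZ /= -!scalemxAl -scalemxAr !mxE; ring.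
Qed.

Lemma bilinZr n (M : 'M[R]_n) a u v : bilin M u (a *: v) = a * bilin M u v.
Proof. by rewrite /bilin -scalemxAr mxE. Qed.

Lemma bilinZl n (M : 'M[R]_n) a u v : bilin M (a *: u) v = a * bilin M u v.
Proof. by rewrite /bilin linearZ /= -!scalemxAl mxE. Qed.

Lemma quad_delta n (M : 'M[R]_n) i : quad M (delta_mx i 0) = M i i.
Proof. by rewrite /quad trmx_delta -rowE -colE !mxE. Qed.

Lemma bilin_delta n (M : 'M[R]_n) i j :
  bilin M (delta_mx i 0) (delta_mx j 0) = M i j.
Proof. by rewrite /bilin trmx_delta -rowE -colE !mxE. Qed.

(** Polarization: equalities, bounds and limits of symmetric matrices can all be
    read off their quadratic forms. *)
Lemma mx_entry_polarization n (M : 'M[R]_n) i j : M^T = M ->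
  M i j = (quad M (delta_mx i 0 + delta_mx j 0)
           - quad M (delta_mx i 0) - quad M (delta_mx j 0)) / 2.
Proof. move=> symM; by rewrite quad_add // bilin_delta; field. Qed.

Lemma quad_inj n (M N : 'M[R]_n) : M^T = M -> N^T = N ->
  quad M =1 quad N -> M = N.
Proof.
move=> symM symN eqMN; apply/matrixP => i j.
by rewrite mx_entry_polarization // [RHS]mx_entry_polarization // !eqMN.
Qed.

(** The sum of the moduli of the entries is submultiplicative for rectangular
    matrices, which the maximum of the moduli is not. *)
Definition mxsum_norm m n (M : 'M[R]_(m, n)) : R := \sum_i \sum_j `|M i j|.

Lemma mxsum_norm_ge0 m n (M : 'M[R]_(m, n)) : 0 <= mxsum_norm M.
Proof. by apply: sumr_ge0 => i _; apply: sumr_ge0 => j _. Qed.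

Lemma quad_le_sqnorm n (M : 'M[R]_n) v :
  `|quad M v| <= mxsum_norm M * sqnorm v.
Proof.
rewrite quadE /mxsum_norm big_distrl /=.
apply: le_trans (ler_norm_sum _ _ _) _; apply: ler_sum => i _.
rewrite big_distrl /=.
apply: le_trans (ler_norm_sum _ _ _) _; apply: ler_sum => j _.
rewrite normrM ler_wpM2l // ler_norml.
have := coord_sqnorm v i; have := coord_sqnorm v j.
have := sqr_ge0 (v i 0 + v j 0); have := sqr_ge0 (v i 0 - v j 0).
move=> h1 h2 h3 h4; apply/andP; split; nra.
Qed.

Lemma spd_psd n (M : 'M[R]_n) : spd M -> psd M.
Proof.
move=> [symM pM]; split=> // v.
by have [->|v0] := eqVneq v 0; [rewrite quadv0 | rewrite ltW // pM].
Qed.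

Lemma quad_ge0 n (M : 'M[R]_n) v : psd M -> 0 <= quad M v.
Proof. by case. Qed.

Lemma psd0 n : psd (0 : 'M[R]_n).
Proof. by split=> [|v]; rewrite ?trmx0 ?quad0. Qed.

Lemma psdD n (M N : 'M[R]_n) : psd M -> psd N -> psd (M + N).
Proof.
move=> [sM pM] [sN pN]; split=> [|v]; first by rewrite linearD /= sM sN.
by rewrite quadD addr_ge0.
Qed.

Lemma spdD_psd n (M N : 'M[R]_n) : spd M -> psd N -> spd (M + N).
Proof.
move=> [sM pM] [sN pN]; split=> [|v v0]; first by rewrite linearD /= sM sN.
by rewrite quadD ltr_pwDl // pM.
Qed.

Lemma psdZ n a (M : 'M[R]_n) : 0 <= a -> psd M -> psd (a *: M).
Proof.
move=> a0 [sM pM]; split=> [|v]; first by rewrite linearZ /= sM.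
by rewrite quadZ mulr_ge0.
Qed.

Lemma spdZ n a (M : 'M[R]_n) : 0 < a -> spd M -> spd (a *: M).
Proof.
move=> a0 [sM pM]; split=> [|v v0]; first by rewrite linearZ /= sM.
by rewrite quadZ mulr_gt0 // pM.
Qed.

Lemma psd_congr n p (M : 'M[R]_n) (F : 'M[R]_(n, p)) :
  psd M -> psd (F^T *m M *m F).
Proof.
move=> [sM pM]; split=> [|v]; first by rewrite !trmx_mul trmxK sM mulmxA.
by rewrite quad_congr.
Qed.

Lemma spd_congr n p (M : 'M[R]_n) (F : 'M[R]_(n, p)) :
  (forall v : 'cV_p, v != 0 -> F *m v != 0) -> spd M -> spd (F^T *m M *m F).
Proof.
move=> injF [sM pM]; split=> [|v v0]; first by rewrite !trmx_mul trmxK sM mulmxA.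
by rewrite quad_congr pM // injF.
Qed.

Lemma spd1 n : spd (1%:M : 'M[R]_n).
Proof. by split=> [|v v0]; rewrite ?trmx1 // quad_sqnorm sqnorm_gt0. Qed.

(** A vector in the kernel of [M] would annihilate the form. *)
Lemma spd_unit n (M : 'M[R]_n) : spd M -> M \in unitmx.
Proof.
move=> [sM pM]; rewrite -row_free_unit -kermx_eq0; apply/rowV0P => v.
move=> /sub_kermxP vM; apply/eqP/negP => /negP v0.
have : 0 < quad M v^T by rewrite pM // trmx_eq0.
by rewrite /quad trmxK vM mul0mx mxE ltxx.
Qed.

Lemma spd_inv n (M : 'M[R]_n) : spd M -> spd (invmx M).
Proof.
move=> sM; have uM := spd_unit sM; case: (sM) => symM pM.
have symI : (invmx M)^T = invmx M by rewrite trmx_inv symM.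
have -> : invmx M = (invmx M)^T *m M *m invmx M by rewrite symI mulVmx // mul1mx.
apply: spd_congr => // v; apply: contraNneq => Mv0.
by rewrite -[v]mul1mx -(mulmxV uM) -mulmxA Mv0 mulmx0.
Qed.

(** The form is nonnegative at [quad M v *: u - bilin M u v *: v]. *)
Lemma bilin_Cauchy_Schwarz n (M : 'M[R]_n) u v : spd M ->
  bilin M u v ^+ 2 <= quad M u * quad M v.
Proof.
move=> sM; have [symM pM] := sM.
have [->|v0] := eqVneq v 0.
  by rewrite quadv0 mulr0 /bilin mulmx0 mxE expr0n.
have := quad_ge0 (quad M v *: u + (- bilin M u v) *: v) (spd_psd sM).
rewrite quad_add // !quad_scale bilinZl bilinZr.
have := pM _ v0; set q := quad M v; set p := quad M u; set b := bilin _ _ _.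
move=> q0 h; have : 0 <= q * (p * q - b ^+ 2).
  by apply: le_trans h _; rewrite le_eqVlt; apply/orP; left; apply/eqP; ring.
by rewrite pmulr_rge0 // subr_ge0.
Qed.

(** The i-th coordinate of [v] is the [M]-scalar product of [M^-1 e_i] and [v], so
    Cauchy-Schwarz gives the explicit constant tr(M^-1); the extra 1 only keeps
    the constant positive in dimension 0. *)
Lemma spd_coercive n (M : 'M[R]_n) : spd M ->
  exists2 K, 0 < K & forall v, sqnorm v <= K * quad M v.
Proof.
move=> sM; exists (1 + \sum_i invmx M i i) => [|v].
  rewrite ltr_wpDr // sumr_ge0 // => i _.
  by rewrite -quad_delta quad_ge0 //; apply/spd_psd/spd_inv.
rewrite mulrDl mul1r.
suff h : sqnorm v <= (\sum_i invmx M i i) * quad M v.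
  by apply: le_trans h _; rewrite lerDr quad_ge0 //; apply: spd_psd.
rewrite sqnormE big_distrl /=; apply: ler_sum => i _.
have uM := spd_unit sM; have [symM _] := sM.
have := bilin_Cauchy_Schwarz (invmx M *m delta_mx i 0) v sM.
have -> : bilin M (invmx M *m delta_mx i 0) v = v i 0.
  rewrite /bilin trmx_mul trmx_inv symM -!mulmxA mulmxA mulmxA.
  by rewrite -[_ *m invmx M *m M]mulmxA mulVmx // mulmx1 trmx_delta -rowE mxE.
rewrite -quad_congr trmx_inv symM mulVmx // mul1mx quad_delta //.
Qed.

Lemma quad_dominated n (N M : 'M[R]_n) : spd M ->
  exists2 K, 0 < K & forall v, quad N v <= K * quad M v.
Proof.
move=> sM; have [K K0 hK] := spd_coercive sM.
have N0 := mxsum_norm_ge0 N.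
exists ((mxsum_norm N + 1) * K) => [|v]; first by rewrite mulr_gt0 // ltr_wpDl.
apply: le_trans (ler_norm _) _; apply: le_trans (quad_le_sqnorm _ _) _.
rewrite -mulrA; apply: (@le_trans _ _ ((mxsum_norm N + 1) * sqnorm v)).
  by rewrite ler_wpM2r ?sqnorm_ge0 // lerDl.
by rewrite ler_wpM2l ?hK // addr_ge0.
Qed.

Lemma mxrank_inj n m (B : 'M[R]_(n, m)) : \rank B = m ->
  forall v : 'cV_m, v != 0 -> B *m v != 0.
Proof.
move=> rB v; apply: contraNneq => Bv0.
have fB : row_free B^T by rewrite /row_free mxrank_tr rB.
apply/eqP; apply: trmx_inj; apply: (row_free_inj fB).
by rewrite -trmx_mul Bv0 !trmx0 mul0mx.
Qed.

End QuadraticForms.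

(** * Powers of a matrix and its spectrum *)

Section Spectrum.
Context {R : realType}.
Local Notation C := (complex R).
Local Notation normc := (@ComplexField.Normc.normc R).

Lemma normc_ge0 (z : C) : 0 <= normc z.
Proof. by case: z => a b; rewrite /= sqrtr_ge0. Qed.

Lemma normc_real (x : R) : normc (real_complex R x) = `|x|.
Proof. by rewrite /= expr0n /= addr0 sqrtr_sqr. Qed.

Definition geometric_bound (r : R) n (U : nat -> 'M[C]_n) : Prop :=
  exists2 K, 0 <= K & forall t i j, normc (U t i j) <= K * r ^+ t.

(** If [u (t+1) = z u t + f t] with [|f t| <= K r^t], then [|u t| <= K' r^t]
    propagates as soon as [|z| K' + K <= r K'], that is [K' >= K / (r - |z|)]. *)
Lemma geometric_bound_recurrence (r : R) (z : C) n (U : nat -> 'M[C]_n) :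
  normc z < r -> geometric_bound r (fun t => U t.+1 - z *: U t) ->
  geometric_bound r U.
Proof.
move=> zr [K K0 hK]; have r0 : 0 <= r by rewrite (le_trans (normc_ge0 z)) ?ltW.
have rz0 : 0 < r - normc z by rewrite subr_gt0.
pose U0 := \sum_i \sum_j normc (U 0%N i j).
have U00 : 0 <= U0.
  by do 2!(apply: sumr_ge0 => ? _); apply: normc_ge0.
exists (U0 + K / (r - normc z)); first by rewrite addr_ge0 // divr_ge0 // ltW.
set K' := U0 + _; move=> t i j; elim: t => [|t IH].
  rewrite expr0 mulr1 /K' -[leLHS]addr0 lerD //; last by rewrite divr_ge0 // ltW.
  rewrite /U0 (bigD1 i) //= (bigD1 j) //= -addrA lerDl addr_ge0 //.
    by apply: sumr_ge0 => ? _; apply: normc_ge0.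
  by do 2!(apply: sumr_ge0 => ? _); apply: normc_ge0.
have := hK t i j; rewrite !mxE => hKt.
have -> : U t.+1 i j = (U t.+1 i j - z * U t i j) + z * U t i j by rewrite subrK.
apply: le_trans (le_normcD _ _) _.
rewrite ComplexField.Normc.normcM.
apply: (@le_trans _ _ (K * r ^+ t + normc z * (K' * r ^+ t))).
  by rewrite lerD // ler_wpM2l // normc_ge0.
have -> : K * r ^+ t + normc z * (K' * r ^+ t) = (K + normc z * K') * r ^+ t.
  by ring.
have -> : K' * r ^+ t.+1 = (r * K') * r ^+ t by rewrite exprS; ring.
rewrite ler_wpM2r ?exprn_ge0 //.
rewrite -lerBrDr -mulrBl.
apply: (@le_trans _ _ ((r - normc z) * (K / (r - normc z)))).
  by rewrite mulrC divfK // gt_eqF.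
by rewrite ler_wpM2l ?(ltW rz0) // /K' lerDr.
Qed.

(** By Cayley-Hamilton the product of the [A - z] over the eigenvalues [z]
    vanishes.  Multiplied by [A ^+ t] it therefore has a trivial bound, and the
    factors are removed one at a time by [geometric_bound_recurrence]. *)
Lemma geometric_bound_powers (r : R) n (A : 'M[C]_n.+1) :
  (forall z, eigenvalue A z -> normc z < r) ->
  geometric_bound r (fun t => A ^+ t).
Proof.
move=> hr.
have [s ps] := closed_field_poly_normal (char_poly A).
rewrite (monicP (char_poly_monic A)) scale1r in ps.
have hs z : z \in s -> normc z < r.
  by move=> zs; apply: hr; rewrite eigenvalue_root_char ps root_prod_XsubC.
have : geometric_bound r (fun t => A ^+ t * \prod_(z <- s) (A - z%:M)).
  have -> : \prod_(z <- s) (A - z%:M) = 0.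
    rewrite -(Cayley_Hamilton A) ps rmorph_prod /=.
    by apply: eq_bigr => z _; rewrite rmorphB /= horner_mx_X horner_mx_C.
  by exists 0 => // t i j; rewrite mulr0 mxE mul0r ComplexField.Normc.normc0.
elim: s hs {ps} => [|z s IH] hs.
  by rewrite big_nil; under eq_fun do rewrite mulr1.
rewrite big_cons => h; apply: IH => [y ys|]; first by rewrite hs // in_cons ys orbT.
apply: (geometric_bound_recurrence (z := z)); first by rewrite hs // mem_head.
suff -> : (fun t => A ^+ t.+1 * \prod_(j <- s) (A - j%:M)
      - z *: (A ^+ t * \prod_(j <- s) (A - j%:M)))
    = (fun t => A ^+ t * ((A - z%:M) * \prod_(j <- s) (A - j%:M))) by [].
apply/funext => t; rewrite exprSr !mulrA mulrBr mulrBl; congr (_ - _).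
by rewrite -!mulmxE mul_mx_scalar -scalemxAl.
Qed.

Lemma real_powers_bound (r : R) n (A : 'M[R]_n) :
  (forall z, complex_eigenvalue A z -> normc z < r) ->
  exists2 K, 0 <= K & forall t i j, `|(A ^+ t) i j| <= K * r ^+ t.
Proof.
case: n A => [|n] A hA; first by exists 0 => // t [].
have [K K0 hK] := geometric_bound_powers hA.
exists K => // t i j; have := hK t i j.
by rewrite -rmorphXn /= !mxE -normc_real.
Qed.

(** The supremum is a genuine one because the spectrum, being the set of roots
    of the characteristic polynomial, is bounded. *)
Lemma le_spectral_radius n (A : 'M[R]_n) z :
  complex_eigenvalue A z -> normc z <= spectral_radius A.
Proof.
move=> zA; apply: ub_le_sup; last by exists z.
pose p := char_poly (map_mx (real_complex R) A).
have [s ps] := closed_field_poly_normal p.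
rewrite (monicP (char_poly_monic _)) scale1r in ps.
exists (\sum_(y <- s) normc y) => _ [y yA <-].
have ys : y \in s.
  by move: yA; rewrite /complex_eigenvalue eigenvalue_root_char -/p ps root_prod_XsubC.
rewrite (big_rem y) //= lerDl.
by apply: sumr_ge0 => ? _; apply: normc_ge0.
Qed.

(** [S] is a multiple of the truncated series of the
    [gamma^t (A^t)^T A^t], [t < T].  Passing from x to A x with the factor
    [gamma] shifts the series, which leaves |x|^2 - gamma^T |A^T x|^2; for [T]
    large the second term is at most half of the first. *)
Lemma discounted_lyapunov (r gamma : R) n (A N : 'M[R]_n) :
  0 < r -> 0 <= gamma -> gamma * r ^+ 2 < 1 ->
  (forall z, complex_eigenvalue A z -> normc z < r) ->
  exists2 S, psd S &
    forall x, quad N x + gamma * quad S (A *m x) <= quad S x.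
Proof.
move=> r0 g0 gr1 hA; have [K K0 hK] := real_powers_bound hA.
have hpow t x : sqnorm (A ^+ t *m x) <= n%:R ^+ 3 * K ^+ 2 * (r ^+ 2) ^+ t * sqnorm x.
  rewrite -quad_sqnorm -quad_congr mulmx1.
  apply: le_trans (ler_norm _) _; apply: le_trans (quad_le_sqnorm _ _) _.
  rewrite ler_wpM2r ?sqnorm_ge0 //.
  (* each entry of (A^t)^T A^t is a sum of n products bounded by (K r^t)^2 *)
  apply: (@le_trans _ _ (\sum_(i < n) \sum_(j < n) n%:R * (K * r ^+ t) ^+ 2)).
    apply: ler_sum => i _; apply: ler_sum => j _; rewrite !mxE.
    apply: le_trans (ler_norm_sum _ _ _) _.
    apply: (@le_trans _ _ (\sum_(k < n) (K * r ^+ t) ^+ 2)).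
      apply: ler_sum => k _; rewrite !mxE normrM expr2 ler_pM //; exact: hK.
    by rewrite sumr_const card_ord mulr_natl.
  rewrite !sumr_const card_ord -[(_ *+ n) *+ n]mulr_natl -[_ *+ n]mulr_natl.
  by rewrite exprMn -!exprM (mulnC t 2) le_eqVlt; apply/orP; left; apply/eqP; ring.
set C3 := n%:R ^+ 3 * K ^+ 2 in hpow.
have C30 : 0 <= C3 by rewrite mulr_ge0 // exprn_ge0.
have [T hT] : exists T, gamma ^+ T * (C3 * (r ^+ 2) ^+ T) <= 2^-1.
  have q0 : 0 <= gamma * r ^+ 2 by rewrite mulr_ge0 // exprn_ge0 // ltW.
  have /cvg_expr : `|gamma * r ^+ 2| < 1 by rewrite ger0_norm.
  move=> /(cvgrPdist_le _ _).1 /(_ (2^-1 / (C3 + 1))).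
  case=> [|T _ /(_ T (leqnn T))]; first by rewrite divr_gt0 // ltr_wpDl.
  rewrite /= sub0r normrN ger0_norm ?exprn_ge0 // => h; exists T.
  rewrite mulrCA -exprMn; move: h; rewrite ler_pdivlMr ?ltr_wpDl // mulrDr mulr1 mulrC.
  by apply: le_trans; rewrite lerDl exprn_ge0.
pose a := 2 * mxsum_norm N.
have a0 : 0 <= a by rewrite mulr_ge0 // mxsum_norm_ge0.
pose S := a *: \sum_(t < T) gamma ^+ t *: ((A ^+ t)^T *m 1%:M *m A ^+ t).
have quadS x : quad S x = a * \sum_(t < T) gamma ^+ t * sqnorm (A ^+ t *m x).
  rewrite quadZ quad_sum; congr (_ * _); apply: eq_bigr => t _.
  by rewrite quadZ quad_congr quad_sqnorm.
exists S => [|x].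
  apply: psdZ => //; apply: (big_ind (@psd R n)) => [||t _].
  - exact: psd0.
  - exact: psdD.
  - by apply: psdZ; [rewrite exprn_ge0 | apply/psd_congr/spd_psd/spd1].
rewrite !quadS.
have shift : sqnorm x + gamma * (\sum_(t < T) gamma ^+ t * sqnorm (A ^+ t *m (A *m x)))
    = \sum_(t < T) gamma ^+ t * sqnorm (A ^+ t *m x) + gamma ^+ T * sqnorm (A ^+ T *m x).
  rewrite -[RHS](big_ord_recr T (fun t => gamma ^+ t * sqnorm (A ^+ t *m x))).
  rewrite big_ord_recl /= expr0 mul1r expr0 mul1mx; congr (_ + _).
  rewrite big_distrr /=; apply: eq_bigr => t _.
  rewrite /bump /= add1n !exprS mulrA -/(A * A ^+ t)%R.
  by rewrite -(exprS A) exprSr -mulmxA.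
have hTx : gamma ^+ T * sqnorm (A ^+ T *m x) <= 2^-1 * sqnorm x.
  apply: (@le_trans _ _ (gamma ^+ T * (C3 * (r ^+ 2) ^+ T * sqnorm x))).
    by rewrite ler_wpM2l ?exprn_ge0 ?hpow.
  by rewrite mulrA ler_wpM2r ?sqnorm_ge0.
have hN : quad N x <= mxsum_norm N * sqnorm x.
  by apply: le_trans (ler_norm _) (quad_le_sqnorm _ _).
move: shift hTx; set s1 := \sum_(t < T) _; set s2 := \sum_(t < T) _ => shift hTx.
have -> : gamma * (a * s1) = a * (s2 - sqnorm x + gamma ^+ T * sqnorm (A ^+ T *m x)).
  have -> : s2 = sqnorm x + gamma * s1 - gamma ^+ T * sqnorm (A ^+ T *m x).
    by rewrite shift addrK.
  ring.
apply: (@le_trans _ _ (mxsum_norm N * sqnorm x + a * (s2 - 2^-1 * sqnorm x))).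
  by rewrite lerD // ler_wpM2l //; lra.
by rewrite /a le_eqVlt; apply/orP; left; apply/eqP; field.
Qed.

End Spectrum.

(** * The Riccati equation as a Bellman fixed point *)

Section EntrywiseConvergence.
Context {R : realType}.

(** Convergence entry by entry, to which the rules for sums and products of real
    sequences apply directly. *)
Definition mx_cvg m n (U : nat -> 'M[R]_(m, n)) (L : 'M[R]_(m, n)) : Prop :=
  forall i j, U k i j @[k --> \oo] --> L i j.

Lemma mx_cvg_cst m n (L : 'M[R]_(m, n)) : mx_cvg (fun=> L) L.
Proof. by move=> i j; apply: cvg_cst. Qed.

Lemma mx_cvgD m n (U V : nat -> 'M[R]_(m, n)) L M :
  mx_cvg U L -> mx_cvg V M -> mx_cvg (fun k => U k + V k) (L + M).
Proof.
by move=> hU hV i j; rewrite mxE; under eq_fun do rewrite mxE; apply: cvgD.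
Qed.

Lemma mx_cvgZ m n a (U : nat -> 'M[R]_(m, n)) L :
  mx_cvg U L -> mx_cvg (fun k => a *: U k) (a *: L).
Proof.
by move=> hU i j; rewrite mxE; under eq_fun do rewrite mxE; apply: cvgMr.
Qed.

Lemma mx_cvgM m n p (U : nat -> 'M[R]_(m, n)) (V : nat -> 'M[R]_(n, p)) L M :
  mx_cvg U L -> mx_cvg V M -> mx_cvg (fun k => U k *m V k) (L *m M).
Proof.
move=> hU hV i j; rewrite mxE; under eq_fun do rewrite mxE.
by apply: (cvg_big add_continuous) => k _; apply: cvgM.
Qed.

Lemma cvg_det n (U : nat -> 'M[R]_n) L :
  mx_cvg U L -> \det (U k) @[k --> \oo] --> \det L.
Proof.
move=> hU; apply: (cvg_big add_continuous) => s _.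
by apply: cvgMr; apply: (cvg_big mul_continuous) => i _; apply: hU.
Qed.

(** The inverse is a rational function of the entries, by the adjugate formula. *)
Lemma mx_cvg_inv n (U : nat -> 'M[R]_n) L :
  (forall k, U k \in unitmx) -> L \in unitmx ->
  mx_cvg U L -> mx_cvg (fun k => invmx (U k)) (invmx L).
Proof.
move=> uU uL hU i j; rewrite /invmx uL !mxE.
under eq_fun do rewrite uU !mxE.
apply: cvgM; first by apply: cvgV (cvg_det hU); rewrite -unitfE -unitmxE.
apply: cvgMr; apply: cvg_det => i' j'.
by rewrite !mxE; under eq_fun do rewrite !mxE; apply: hU.
Qed.

End EntrywiseConvergence.

Section RiccatiTheory.
Context {R : realType} (n m : nat) (A : 'M[R]_n) (B : 'M[R]_(n, m)).
Context (Q : 'M[R]_n) (gamma : R).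
Implicit Types (W : 'M[R]_m) (P : 'M[R]_n) (F : 'M[R]_(m, n)).

(** The Hessian (up to a factor 2) in [u] of the one-step cost
    [quad W u + gamma * quad P (A *m x + B *m u)]. *)
Definition hess W P : 'M[R]_m := W + gamma *: (B^T *m P *m B).

(** [greedy W P *m x] is the input that minimizes the one-step cost from [x] when
    [P] is the cost of the state reached. *)
Definition greedy W P : 'M[R]_(m, n) :=
  - gamma *: (invmx (hess W P) *m B^T *m P *m A).

(** The right-hand side of the Riccati equation, with the correction written as
    the value of the Hessian at the minimizer. *)
Definition bellman W P : 'M[R]_n :=
  Q + gamma *: (A^T *m P *m A) - (greedy W P)^T *m hess W P *m greedy W P.

Lemma hess_spd W P : 0 <= gamma -> spd W -> psd P -> spd (hess W P).
Proof. by move=> g0 sW sP; apply: spdD_psd => //; apply: psdZ (psd_congr _ _). Qed.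

Lemma hess_greedy W P : hess W P \in unitmx ->
  hess W P *m greedy W P = - gamma *: (B^T *m P *m A).
Proof. by move=> uM; rewrite -scalemxAr !mulmxA mulmxV // mul1mx. Qed.

Lemma greedyB W W' P P' :
  hess W P \in unitmx -> hess W' P' \in unitmx ->
  greedy W P - greedy W' P' = invmx (hess W P) *m
    (- gamma *: (B^T *m (P - P') *m A) - (hess W P - hess W' P') *m greedy W' P').
Proof.
move=> uM uM'; rewrite -[LHS](mulKmx uM); congr (_ *m _).
rewrite mulmxBr (hess_greedy uM) mulmxBl [hess W' P' *m greedy W' P'](hess_greedy uM').
by rewrite mulmxBr mulmxBl scalerBr opprB addrA subrK.
Qed.

Lemma bellman_dare W P : 0 < gamma -> P^T = P -> (hess W P)^T = hess W P ->
  hess W P \in unitmx -> dare A B Q gamma W P <-> bellman W P = P.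
Proof.
move=> g0 sP sM uM; rewrite /dare /bellman.
set Y := (X in _ - X = 0 <-> _).
have -> : (greedy W P)^T *m hess W P *m greedy W P = Y.
  rewrite -mulmxA hess_greedy // /Y /greedy.
  have -> : B^T *m P *m B + gamma^-1 *: W = gamma^-1 *: hess W P.
    by rewrite /hess scalerDr scalerA mulVf ?gt_eqF // scale1r addrC.
  rewrite invmxZ; last by rewrite unitmxZ // unitfE invr_eq0 gt_eqF.
  rewrite invrK.
  have -> : (- gamma *: (invmx (hess W P) *m B^T *m P *m A))^T
      = - gamma *: (A^T *m P *m B *m invmx (hess W P)).
    by rewrite linearZ /= !trmx_mul trmx_inv sM sP trmxK !mulmxA.
  rewrite [(Num.sqrt gamma *: A)^T]linearZ /=.
  rewrite !(=^~ scalemxAl, =^~ scalemxAr) !scalerA !mulmxA; congr (_ *: _).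
  transitivity (gamma * (Num.sqrt gamma * Num.sqrt gamma)); last by ring.
  by rewrite -[Num.sqrt gamma * _]expr2 sqr_sqrtr ?(ltW g0) //; ring.
have -> : (Num.sqrt gamma *: A)^T *m P *m (Num.sqrt gamma *: A)
    = gamma *: (A^T *m P *m A).
  rewrite [(Num.sqrt gamma *: A)^T]linearZ /= -!scalemxAl -scalemxAr scalerA.
  by rewrite -expr2 sqr_sqrtr // ltW.
set X := gamma *: _; clearbody X Y; split=> [h|<-].
  by apply/eqP; rewrite -subr_eq0 -h; apply/eqP/matrixP => i j; rewrite !mxE; ring.
by apply/matrixP => i j; rewrite !mxE; ring.
Qed.

(** Completion of the square in [u]: the linear term of the one-step cost is
    [- 2 * bilin (hess W P) u (greedy W P *m x)], by [hess_greedy]. *)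
Lemma bellman_square W P x u : 0 <= gamma -> spd W -> psd P ->
  quad Q x + quad W u + gamma * quad P (A *m x + B *m u)
  = quad (bellman W P) x + quad (hess W P) (u - greedy W P *m x).
Proof.
move=> g0 sW sP; have sM := hess_spd g0 sW sP; have symM := sM.1.
have symP := sP.1.
rewrite (quad_add _ _ symP).
have -> : quad (bellman W P) x
    = quad Q x + gamma * quad P (A *m x) - quad (hess W P) (greedy W P *m x).
  by rewrite /bellman quadD quadD quadN quadZ !quad_congr.
rewrite -[- (greedy W P *m x)]scaleN1r (quad_add _ _ symM) quad_scale bilinZr.
have -> : bilin (hess W P) u (greedy W P *m x) = - gamma * bilin P (B *m u) (A *m x).
  rewrite /bilin mulmxA -[u^T *m _ *m _]mulmxA hess_greedy ?spd_unit //.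
  by rewrite -scalemxAr -scalemxAl mxE trmx_mul !mulmxA.
have -> : quad (hess W P) u = quad W u + gamma * quad P (B *m u).
  by rewrite quadD quadZ quad_congr.
by rewrite (bilinC _ (A *m x)) //; ring.
Qed.

Lemma bellman_le W P x u : 0 <= gamma -> spd W -> psd P ->
  quad (bellman W P) x <= quad Q x + quad W u + gamma * quad P (A *m x + B *m u).
Proof.
move=> g0 sW sP; rewrite (bellman_square x u g0 sW sP) lerDl.
by apply: quad_ge0; apply: spd_psd; apply: hess_spd.
Qed.

Lemma bellman_greedy W P x : 0 <= gamma -> spd W -> psd P ->
  quad (bellman W P) x = quad Q x + quad W (greedy W P *m x)
    + gamma * quad P (A *m x + B *m (greedy W P *m x)).
Proof.
move=> g0 sW sP; rewrite (bellman_square x _ g0 sW sP).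
by rewrite subrr quadv0 addr0.
Qed.

Lemma bellman_psd W P : 0 <= gamma -> spd W -> psd P -> psd Q ->
  psd (bellman W P).
Proof.
move=> g0 sW sP [symQ pQ]; split=> [|x].
  have symM := (hess_spd g0 sW sP).1; have symP := sP.1.
  rewrite /bellman linearB linearD linearZ /= !trmx_mul !trmxK symQ symM symP.
  by rewrite !mulmxA.
rewrite bellman_greedy // !addr_ge0 // ?mulr_ge0 // ?quad_ge0 //.
exact: spd_psd.
Qed.

(** Suppose [P <= k P'] with [k >= 1].  One step of the feedback [F] gives
    [P <= k P' - (k - 1) (Q + F^T W F)], and [Q >= e P'] for some [e > 0] since
    [Q] is definite, so [k - 1] can be replaced by [(1 - e) (k - 1)].  Iterating,
    [k] tends to 1. *)
Lemma bellman_comparison W P P' F : 0 <= gamma -> spd Q -> psd W -> psd P' ->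
  (forall x u, quad P x <= quad Q x + quad W u + gamma * quad P (A *m x + B *m u)) ->
  (forall x, quad Q x + quad W (F *m x) + gamma * quad P' (A *m x + B *m (F *m x))
     <= quad P' x) ->
  forall x, quad P x <= quad P' x.
Proof.
move=> g0 sQ sW sP' subP supP'.
have QP' x : quad Q x <= quad P' x.
  apply: le_trans (supP' x); rewrite -addrA lerDl addr_ge0 ?mulr_ge0 //.
    exact: quad_ge0.
  exact: quad_ge0.
have spdP' : spd P'.
  by split=> [|v v0]; [case: sP' | apply: lt_le_trans (QP' v); apply: sQ.2].
have [k k0 hk] := quad_dominated P spdP'.
have [K K0 hK] := quad_dominated P' sQ.
have [e e0 he] : exists2 e, 0 < e < 1 & forall x, e * quad P' x <= quad Q x.
  exists (K + 1)^-1; first by rewrite invr_gt0 invf_lt1 ?ltrDr ?addr_gt0.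
  move=> x; rewrite mulrC ler_pdivrMr ?addr_gt0 //.
  apply: le_trans (hK x) _; rewrite mulrC ler_wpM2l ?quad_ge0 ?lerDl //.
  exact: spd_psd.
have iter N x : quad P x <= (1 + (1 - e) ^+ N * k) * quad P' x.
  elim: N x => [|N IH] x.
    rewrite expr0 mul1r mulrDl mul1r; apply: le_trans (hk x) _.
    by rewrite lerDr quad_ge0.
  have := subP x (F *m x); have := IH (A *m x + B *m (F *m x)).
  have := supP' x; have := he x.
  have := quad_ge0 (F *m x) sW.
  have : 0 <= (1 - e) ^+ N * k.
    by rewrite mulr_ge0 ?(ltW k0) // exprn_ge0 //; move: e0; lra.
  rewrite exprS; set c := (1 - e) ^+ N * k.
  set p := quad P' x; set p' := quad P' (_ + _); set q := quad Q x.
  set w := quad W _; set y := quad P x; set y' := quad P (_ + _).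
  move=> c0 w0 h1 h2 h3 h4.
  have h5 : gamma * y' <= (1 + c) * (gamma * p').
    by rewrite mulrCA ler_wpM2l.
  have h6 : (1 + c) * (q + w + gamma * p') <= (1 + c) * p.
    by rewrite ler_wpM2l // addr_ge0.
  have h7 : c * (e * p) <= c * q by rewrite ler_wpM2l.
  have h8 : 0 <= c * w by rewrite mulr_ge0.
  have -> : (1 - e) * (1 - e) ^+ N * k = (1 - e) * c by rewrite /c mulrA.
  nra.
move=> x; have e1 : `|1 - e| < 1 by move: e0; rewrite ltr_norml; lra.
have lim1 : (1 + (1 - e) ^+ N * k) * quad P' x @[N --> \oo]
    --> (1 + 0 * k) * quad P' x.
  apply: cvgMl; apply: cvgD; first exact: cvg_cst.
  by apply: cvgMl; apply: cvg_expr.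
rewrite mul0r addr0 mul1r in lim1.
apply: (ler_cvg_to (cvg_cst (quad P x)) lim1).
by near=> N; apply: iter.
Unshelve. all: by end_near. Qed.

Lemma riccati_unique W P P' : 0 < gamma -> spd Q -> spd W -> psd P -> psd P' ->
  bellman W P = P -> bellman W P' = P' -> P = P'.
Proof.
move=> g0 sQ sW sP sP' eP eP'; have g0' := ltW g0.
apply: quad_inj; [exact: sP.1 | exact: sP'.1 | move=> x].
apply/eqP; rewrite eq_le; apply/andP; split.
  apply: (bellman_comparison (W := W) (F := greedy W P')) => //.
  - exact: spd_psd.
  - by move=> y u; rewrite -{1}eP; apply: bellman_le.
  - by move=> y; rewrite -bellman_greedy // eP'.
apply: (bellman_comparison (W := W) (F := greedy W P)) => //.
- exact: spd_psd.
- by move=> y u; rewrite -{1}eP'; apply: bellman_le.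
- by move=> y; rewrite -bellman_greedy // eP.
Qed.

(** Value iteration from 0 increases, since each step is a minimum of monotone
    maps, and it stays below the super-solution [S].  The forms therefore
    converge, hence so do the matrices by polarization, and the limit is a fixed
    point because the Bellman map is continuous. *)
Lemma riccati_exists W S F : 0 < gamma -> spd Q -> spd W -> psd S ->
  (forall x, quad Q x + quad W (F *m x) + gamma * quad S (A *m x + B *m (F *m x))
     <= quad S x) ->
  exists P, spd P /\ bellman W P = P.
Proof.
move=> g0 sQ sW sS supS; have g0' := ltW g0.
pose V k := iter k (bellman W) 0.
have psdV k : psd (V k).
  by elim: k => [|k IH]; [apply: psd0 | apply: bellman_psd => //; apply: spd_psd].
have leV k x : quad (V k) x <= quad (V k.+1) x.
  elim: k x => [|k IH] x; first by rewrite quad0 quad_ge0 //; apply: psdV 1%N.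
  rewrite [leRHS](bellman_greedy x g0' sW (psdV k.+1)).
  apply: le_trans (bellman_le _ (greedy W (V k.+1) *m x) g0' sW (psdV k)) _.
  by rewrite lerD2l ler_wpM2l.
have ubV k x : quad (V k) x <= quad S x.
  elim: k x => [|k IH] x; first by rewrite quad0 quad_ge0.
  apply: le_trans (supS x).
  apply: le_trans (bellman_le _ (F *m x) g0' sW (psdV k)) _.
  by rewrite lerD2l ler_wpM2l.
have cvgV x : cvgn (fun k => quad (V k) x).
  apply: nondecreasing_is_cvgn.
    by apply/nondecreasing_seqP => k; apply: leV.
  by exists (quad S x) => _ [k _ <-].
pose L : 'M[R]_n := \matrix_(i, j) limn (fun k => V k i j).
have hL : mx_cvg V L.
  move=> i j; rewrite mxE; suff : cvgn (fun k => V k i j) by [].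
  have -> : (fun k => V k i j) = (fun k => (quad (V k) (delta_mx i 0 + delta_mx j 0)
      - quad (V k) (delta_mx i 0) - quad (V k) (delta_mx j 0)) / 2).
    by apply/funext => k; apply: mx_entry_polarization (psdV k).1.
  by apply: cvgP; apply: cvgMl; apply: cvgB; [apply: cvgB|]; apply: cvgV.
have quadL x : quad (V k) x @[k --> \oo] --> quad L x.
  by apply: mx_cvgM; [apply: mx_cvgM => //|]; apply: mx_cvg_cst.
have symL : L^T = L.
  apply/matrixP => i j; rewrite !mxE; congr (limn _); apply/funext => k.
  by rewrite -[in LHS](psdV k).1 mxE.
have psdL : psd L.
  split=> // x; apply: (ler_cvg_to (cvg_cst 0) (quadL x)).
  by near=> k; apply: quad_ge0.
have fixL : bellman W L = L.
  have h1 : mx_cvg (fun k => V k.+1) L 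
    by move=> i j; have := hL i j; rewrite -cvg_shiftS.
  have hH : mx_cvg (fun k => hess W (V k)) (hess W L).
    apply: mx_cvgD; first exact: mx_cvg_cst.
    by apply: mx_cvgZ; do 2!(apply: mx_cvgM; try exact: mx_cvg_cst).
  have hG : mx_cvg (fun k => greedy W (V k)) (greedy W L).
    apply: mx_cvgZ; apply: mx_cvgM; last exact: mx_cvg_cst.
    apply: mx_cvgM => //; apply: mx_cvgM; last exact: mx_cvg_cst.
    by apply: mx_cvg_inv => // [k|]; apply/spd_unit/hess_spd.
  have h2 : mx_cvg (fun k => V k.+1) (bellman W L).
    apply: mx_cvgD.
      apply: mx_cvgD; first exact: mx_cvg_cst.
      by apply: mx_cvgZ; do 2!(apply: mx_cvgM; try exact: mx_cvg_cst).
    rewrite -scaleN1r.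
    under [X in mx_cvg X]eq_fun do rewrite -scaleN1r.
    apply: mx_cvgZ; apply: mx_cvgM => //; apply: mx_cvgM => // i j.
    by rewrite mxE; under eq_fun do rewrite mxE; apply: hG.
  apply/matrixP => i j; apply: cvg_unique (h2 i j) (h1 i j) => //.
exists L; split=> //; split=> // x x0; rewrite -fixL bellman_greedy //.
rewrite -addrA ltr_pwDl ?sQ.2 // addr_ge0 ?mulr_ge0 // quad_ge0 //.
exact: spd_psd.
Unshelve. all: by end_near. Qed.

End RiccatiTheory.

(** * Dependence of the gain on the control weight *)

Section MatrixNorm.
Context {R : realType}.

Lemma mxsum_normD m n (M N : 'M[R]_(m, n)) :
  mxsum_norm (M + N) <= mxsum_norm M + mxsum_norm N.
Proof.
rewrite /mxsum_norm -big_split /=; apply: ler_sum => i _.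
by rewrite -big_split /=; apply: ler_sum => j _; rewrite mxE ler_normD.
Qed.

Lemma mxsum_normZ m n a (M : 'M[R]_(m, n)) :
  mxsum_norm (a *: M) = `|a| * mxsum_norm M.
Proof.
rewrite /mxsum_norm big_distrr /=; apply: eq_bigr => i _.
by rewrite big_distrr /=; apply: eq_bigr => j _; rewrite mxE normrM.
Qed.

Lemma mxsum_normN m n (M : 'M[R]_(m, n)) : mxsum_norm (- M) = mxsum_norm M.
Proof. by rewrite -scaleN1r mxsum_normZ normrN normr1 mul1r. Qed.

Lemma mxsum_normM m n p (M : 'M[R]_(m, n)) (N : 'M[R]_(n, p)) :
  mxsum_norm (M *m N) <= mxsum_norm M * mxsum_norm N.
Proof.
rewrite {1 2}/mxsum_norm big_distrl /=; apply: ler_sum => i _.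
rewrite big_distrl /=.
apply: (@le_trans _ _ (\sum_j \sum_k `|M i k| * `|N k j|)).
  apply: ler_sum => j _; rewrite mxE; apply: le_trans (ler_norm_sum _ _ _) _.
  by apply: ler_sum => k _; rewrite normrM.
rewrite exchange_big /=; apply: ler_sum => k _.
rewrite -big_distrr /= ler_wpM2l // /mxsum_norm [leRHS](bigD1 k) //= lerDl.
by apply: sumr_ge0 => ? _; apply: sumr_ge0.
Qed.

Lemma mx_norm_le_mxsum m n (M : 'M[R]_(m, n)) : `|M| <= mxsum_norm M.
Proof.
rewrite [`|M|]mx_normrE; apply/bigmax_leP; split; first exact: mxsum_norm_ge0.
move=> [i j] _ /=; rewrite /mxsum_norm (bigD1 i) //= (bigD1 j) //=.
rewrite -addrA lerDl addr_ge0 //; first exact: sumr_ge0.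
by apply: sumr_ge0 => ? _; apply: sumr_ge0.
Qed.

(** Bounds between quadratic forms are turned into bounds on matrices: by
    polarization each entry of [D] is controlled by three values of its form. *)
Lemma mxsum_norm_quad n (P : 'M[R]_n) :
  exists2 K, 0 <= K & forall (D : 'M[R]_n) d, D^T = D -> 0 <= d ->
    (forall x, `|quad D x| <= d * quad P x) -> mxsum_norm D <= K * d.
Proof.
pose p i j := `|(quad P (delta_mx i 0 + delta_mx j 0)
               + quad P (delta_mx i 0) + quad P (delta_mx j 0)) / 2|.
exists (\sum_i \sum_j p i j) => [|D d symD d0 hD].
  by do 2!(apply: sumr_ge0 => ? _); apply: normr_ge0.
rewrite /mxsum_norm big_distrl /=; apply: ler_sum => i _.
rewrite big_distrl /=; apply: ler_sum => j _.
rewrite mx_entry_polarization //.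
apply: (@le_trans _ _ ((quad P (delta_mx i 0 + delta_mx j 0)
   + quad P (delta_mx i 0) + quad P (delta_mx j 0)) / 2 * d)); last first.
  by rewrite ler_wpM2r // ler_norm.
have := hD (delta_mx i 0); have := hD (delta_mx j 0).
have := hD (delta_mx i 0 + delta_mx j 0).
by rewrite !ler_norml => /andP[h1 h2] /andP[h3 h4] /andP[h5 h6]; apply/andP; split; lra.
Qed.

(** A form bounded below by [M0] has inverse bounded by a constant depending on
    [M0] only: if [v = M^-1 e_j] then the form of [M] at [v] is the coordinate
    [v_j], and coercivity gives [|v|^2 <= K v_j], so that [|v| <= K]. *)
Lemma mxsum_norm_inv n (M0 : 'M[R]_n) : spd M0 ->
  exists2 K, 0 <= K & forall M : 'M[R]_n, spd M ->
    (forall x, quad M0 x <= quad M x) -> mxsum_norm (invmx M) <= K.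
Proof.
move=> sM0; have [K K0 hK] := spd_coercive sM0.
exists (\sum_(i < n) \sum_(j < n) K) => [|M sM hM].
  by do 2!(apply: sumr_ge0 => ? _); apply: ltW.
have uM := spd_unit sM.
apply: ler_sum => i _; apply: ler_sum => j _.
pose v := invmx M *m delta_mx j (0 : 'I_1).
have vij : v i 0 = invmx M i j by rewrite /v -colE mxE.
have vM : quad M v = v j 0.
  by rewrite /quad -mulmxA {2}/v mulKVmx // -colE !mxE.
have h1 : sqnorm v <= K * v j 0.
  by rewrite -vM; apply: le_trans (hK v) _; rewrite ler_wpM2l ?hM // ltW.
have hi := coord_sqnorm v i; have hj := coord_sqnorm v j.
rewrite -vij.
have hj2 : v j 0 <= K.
  have : v j 0 * v j 0 <= K * v j 0 by rewrite -expr2; apply: le_trans hj h1.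
  have [vj0|vj0] := lerP (v j 0) 0; first by move=> _; apply: le_trans vj0 (ltW K0).
  by rewrite ler_pM2r.
rewrite -(ler_pXn2r (n := 2)) ?nnegrE ?(ltW K0) // -normrX ger0_norm ?sqr_ge0 //.
apply: le_trans hi _; apply: le_trans h1 _.
by rewrite expr2 ler_wpM2l // ltW.
Qed.

End MatrixNorm.

Section OptimalGain.
Context {R : realType} (n m : nat) (A : 'M[R]_n) (B : 'M[R]_(n, m)).
Context (Q : 'M[R]_n) (gamma : R).
Context (sysA : system_assumptions A B Q gamma).

Let g01 : 0 < gamma < 1. Proof. by case: sysA. Qed.
Let g0 : 0 < gamma. Proof. by case/andP: g01. Qed.
Let g0' : 0 <= gamma. Proof. exact: ltW. Qed.
Let sQ : spd Q. Proof. by case: sysA. Qed.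
Let injB (v : 'cV_m) : v != 0 -> B *m v != 0.
Proof. by apply: mxrank_inj; case: sysA. Qed.

(** Stability of [A + B F] bounds the powers of the closed loop, and the discount
    [gamma < 1] then provides the super-solution needed by [riccati_exists]. *)
Lemma riccati_exists_unique W : spd W ->
  exists! P, spd P /\ dare A B Q gamma W P.
Proof.
move=> sW; have [_ [F stabF] _ _ _] := sysA.
have [|S sS hS] := @discounted_lyapunov R 1 gamma n (A + B *m F)
  (Q + F^T *m W *m F) ltr01 g0' _ stabF.
  by rewrite expr1n mulr1; case/andP: g01.
have eqD P : psd P -> dare A B Q gamma W P <-> bellman A B Q gamma W P = P.
  move=> sP; have sH := hess_spd B g0' sW sP.
  by apply: bellman_dare => //; [apply: sP.1 | apply: sH.1 | apply: spd_unit].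
have [|P [sP eP]] := riccati_exists (A := A) (B := B) (S := S) (F := F) g0 sQ sW sS.
  move=> x; have := hS x; rewrite quadD quad_congr mulmxDl -mulmxA; exact.
exists P; split=> [|P' [sP' eP']].
  by split=> //; apply/eqD => //; apply: spd_psd.
apply: (riccati_unique g0 sQ sW (spd_psd sP) (spd_psd sP') eP).
by apply/eqD => //; apply: spd_psd.
Qed.

Lemma riccati_spec W : spd W ->
  spd (riccati A B Q gamma W)
  /\ bellman A B Q gamma W (riccati A B Q gamma W) = riccati A B Q gamma W.
Proof.
move=> sW; have [P [solP _]] := riccati_exists_unique sW.
have [sP dP] := xgetI (P := [set P | spd P /\ dare A B Q gamma W P]) 0 solP.
split=> //; have sP' := spd_psd sP; have sH := hess_spd B g0' sW sP'.
by apply/bellman_dare => //; [apply: sP.1 | apply: sH.1 | apply: spd_unit].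
Qed.

Lemma riccati_le_supersolution W P' F : spd W -> psd P' ->
  (forall x, quad Q x + quad W (F *m x) + gamma * quad P' (A *m x + B *m (F *m x))
     <= quad P' x) ->
  forall x, quad (riccati A B Q gamma W) x <= quad P' x.
Proof.
move=> sW sP' supP'; have [sP eP] := riccati_spec sW.
apply: (bellman_comparison g0' sQ (spd_psd sW) sP' _ supP') => x u.
by rewrite -{1}eP; apply: bellman_le => //; apply: spd_psd.
Qed.

Lemma riccati_ge_cost W x : spd W -> quad Q x <= quad (riccati A B Q gamma W) x.
Proof.
move=> sW; have [sP eP] := riccati_spec sW; have sP' := spd_psd sP.
rewrite -[leRHS](congr1 (fun N => quad N x) eP) bellman_greedy // -addrA lerDl.
rewrite addr_ge0 ?mulr_ge0 ?quad_ge0 //.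
exact: spd_psd.
Qed.

Local Notation W s := (s *: (B^T *m B)).
Local Notation P s := (riccati A B Q gamma (W s)).
Local Notation F s := (greedy A B gamma (W s) (P s)).

Lemma BTB_spd : spd (B^T *m B).
Proof. by rewrite -[B^T]mulmx1; apply: spd_congr => //; apply: spd1. Qed.

Lemma weight_spd s : 0 < s -> spd (W s).
Proof. by move=> s0; apply: spdZ => //; apply: BTB_spd. Qed.

(** The solution for the larger weight, with its own gain, is a super-solution
    for the smaller one. *)
Lemma riccati_homo s s' x : 0 < s -> s <= s' -> quad (P s) x <= quad (P s') x.
Proof.
move=> s0 ss'; have s'0 := lt_le_trans s0 ss'.
have [sP eP] := riccati_spec (weight_spd s'0); have sP' := spd_psd sP.
apply: (riccati_le_supersolution (F := F s') (weight_spd s0) sP') => y.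
rewrite -[leRHS](congr1 (fun N => quad N y) eP) bellman_greedy //; last exact: weight_spd.
rewrite lerD2r lerD2l !quadZ ler_wpM2r // quad_ge0 //; exact: spd_psd BTB_spd.
Qed.

(** Multiplying the state cost as well as the control cost by [s' / s >= 1]
    multiplies the value by [s' / s], and increasing the state cost only
    increases the value. *)
Lemma riccati_scale_le s s' x : 0 < s -> s <= s' ->
  quad (P s') x <= s' / s * quad (P s) x.
Proof.
move=> s0 ss'; have s'0 := lt_le_trans s0 ss'.
have [sP eP] := riccati_spec (weight_spd s0); have sP' := spd_psd sP.
have r0 : 0 <= s' / s by rewrite divr_ge0 // ltW.
rewrite -quadZ; apply: (riccati_le_supersolution (F := F s) (weight_spd s'0)).
  exact: psdZ.
move=> y; rewrite !quadZ -[X in _ <= _ * X](congr1 (fun N => quad N y) eP).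
rewrite bellman_greedy //; last exact: weight_spd.
rewrite quadZ !mulrDr [s' / s * (s * _)]mulrA divfK ?gt_eqF //.
rewrite [gamma * _]mulrCA !lerD2r ler_peMl ?quad_ge0 //; first exact: spd_psd.
by rewrite ler_pdivlMr // mul1r.
Qed.

(** The solutions dominate [Q], so the Hessians are bounded below uniformly in
    the weight, even as [s] tends to 0. *)
Lemma hess_ge_cost s : 0 < s -> forall v,
  quad (B^T *m (gamma *: Q) *m B) v <= quad (hess B gamma (W s) (P s)) v.
Proof.
move=> s0 v; rewrite quad_congr quadZ.
have -> : quad (hess B gamma (W s) (P s)) v
    = s * quad (B^T *m B) v + gamma * quad (P s) (B *m v).
  by rewrite quadD !quadZ quad_congr.
rewrite -[leLHS]add0r lerD ?mulr_ge0 ?(ltW s0) ?quad_ge0 //.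
  exact: spd_psd BTB_spd.
by rewrite ler_wpM2l // riccati_ge_cost //; apply: weight_spd.
Qed.

Lemma hess_weight_spd s : 0 < s -> spd (hess B gamma (W s) (P s)).
Proof.
move=> s0; have sW := weight_spd s0; have [sP _] := riccati_spec sW.
by apply: hess_spd => //; apply: spd_psd.
Qed.

(** The form in which the two comparisons between [P s] and [P s'] are used. *)
Lemma ratio_sandwich (s s' p p' q : R) : 0 < s -> s <= s' ->
  p <= p' -> p' <= s' / s * p -> p' <= q -> `|p - p'| <= (1 - s / s') * q.
Proof.
move=> s0 ss' h1 h2 h3; have s'0 := lt_le_trans s0 ss'.
have d0 : 0 <= 1 - s / s' by rewrite subr_ge0 ler_pdivrMr // mul1r.
rewrite distrC ger0_norm ?subr_ge0 //.
apply: (@le_trans _ _ ((1 - s / s') * p')); last by rewrite ler_wpM2l.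
rewrite mulrBl mul1r lerD2l lerN2.
have : s / s' * p' <= s / s' * (s' / s * p).
  by rewrite ler_wpM2l // divr_ge0 // ltW.
suff -> : s / s' * (s' / s * p) = p by [].
by field; rewrite !gt_eqF.
Qed.

(** By [greedyB] the difference of two gains is an inverse Hessian, bounded by
    [hess_ge_cost], applied to differences of solutions and of weights; both are
    of order [1 - s / s'].  The constant is uniform down to [s = 0], which is what
    makes the two weights comparable as [rho] tends to infinity. *)
Lemma gain_lipschitz : exists2 K, 0 < K & forall s s', 0 < s -> s <= s' -> s' <= 1 ->
  `|F s - F s'| <= K * (1 - s / s').
Proof.
have sM0 : spd (B^T *m (gamma *: Q) *m B) by apply: spd_congr => //; apply: spdZ.
have [Ki Ki0 hKi] := mxsum_norm_inv sM0.
have [Kp Kp0 hKp] := mxsum_norm_quad (P 1).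
pose b := mxsum_norm B^T; pose b' := mxsum_norm B; pose a := mxsum_norm A.
pose w := mxsum_norm (B^T *m B).
have [b0 b'0 a0 w0] : [/\ 0 <= b, 0 <= b', 0 <= a & 0 <= w].
  by split; apply: mxsum_norm_ge0.
pose Kf := gamma * (Ki * b * Kp * a).
have Kf0 : 0 <= Kf by rewrite /Kf !mulr_ge0.
pose K := Ki * (gamma * (b * Kp * a) + (w + gamma * (b * Kp * b')) * Kf).
have K0 : 0 <= K by rewrite /K !(mulr_ge0, addr_ge0).
exists (K + 1) => [|s s' s0 ss' s'1]; first by rewrite ltr_wpDl.
have s'0 := lt_le_trans s0 ss'.
have invb r : 0 < r -> mxsum_norm (invmx (hess B gamma (W r) (P r))) <= Ki.
  by move=> r0; apply: hKi; [apply: hess_weight_spd | apply: hess_ge_cost].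
have symP r : 0 < r -> (P r)^T = P r.
  by move=> r0; have [[]] := riccati_spec (weight_spd r0).
have symB (X Y : 'M[R]_n) : X^T = X -> Y^T = Y -> (X - Y)^T = X - Y.
  by move=> hX hY; rewrite linearB /= hX hY.
have pge0 r x : 0 < r -> 0 <= quad (P r) x.
  by move=> r0; apply: quad_ge0; apply: spd_psd; have [] := riccati_spec (weight_spd r0).
have Ps' : mxsum_norm (P s') <= Kp.
  rewrite -[Kp]mulr1; apply: hKp => // [|x]; first exact: symP.
  rewrite (ger0_norm (pge0 _ _ s'0)) mul1r.
  exact: (riccati_homo x s'0 s'1).
set d := 1 - s / s'.
have d0 : 0 <= d by rewrite subr_ge0 ler_pdivrMr // mul1r.
have Dd : mxsum_norm (P s - P s') <= Kp * d.
  apply: hKp => // [|x]; first by apply: symB; apply: symP.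
  have h1 := riccati_homo x s0 ss'; have h2 := riccati_scale_le x s0 ss'.
  have h3 := riccati_homo x s'0 s'1.
  have -> : quad (P s - P s') x = quad (P s) x - quad (P s') x.
    by rewrite quadD quadN.
  exact: ratio_sandwich s0 ss' h1 h2 h3.
have Fb : mxsum_norm (F s') <= Kf.
  rewrite /greedy mxsum_normZ normrN ger0_norm // ler_wpM2l //.
  by do 3!(apply: le_trans (mxsum_normM _ _) _; apply: ler_pM; rewrite ?mxsum_norm_ge0 ?invb //).
have dE : hess B gamma (W s) (P s) - hess B gamma (W s') (P s')
    = - (s' - s) *: (B^T *m B) + gamma *: (B^T *m (P s - P s') *m B).
  by rewrite mulmxBr mulmxBl scalerBr opprB scalerBl opprD addrACA.
have Eb : mxsum_norm (hess B gamma (W s) (P s) - hess B gamma (W s') (P s'))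
    <= (w + gamma * (b * Kp * b')) * d.
  rewrite dE; apply: le_trans (mxsum_normD _ _) _; rewrite !mxsum_normZ normrN mulrDl.
  rewrite ger0_norm ?subr_ge0 // [`|gamma|]ger0_norm //; apply: lerD.
    rewrite mulrC ler_wpM2l // /d.
    have : s' * (1 - s / s') = s' - s by rewrite mulrBr mulr1 mulrC divfK // gt_eqF.
    by move=> <-; rewrite ler_piMl.
  rewrite -mulrA ler_wpM2l //; apply: le_trans (mxsum_normM _ _) _.
  rewrite mulrAC; apply: ler_pM; rewrite ?mxsum_norm_ge0 //.
  apply: le_trans (mxsum_normM _ _) _; rewrite -mulrA.
  by apply: ler_wpM2l.
have uM := spd_unit (hess_weight_spd s0).
apply: le_trans (mx_norm_le_mxsum (F s - F s')) _.
rewrite (greedyB A uM (spd_unit (hess_weight_spd s'0))).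
apply: le_trans (mxsum_normM _ _) _.
apply: (@le_trans _ _ (K * d)); last by rewrite ler_wpM2r // lerDl.
rewrite /K -mulrA; apply: ler_pM; try exact: mxsum_norm_ge0; first exact: invb s s0.
rewrite mulrDl; apply: le_trans (mxsum_normD _ _) _.
rewrite mxsum_normN mxsum_normZ normrN ger0_norm //; apply: lerD.
  rewrite -[leRHS]mulrA ler_wpM2l //; apply: le_trans (mxsum_normM _ _) _.
  rewrite mulrAC; apply: ler_pM; rewrite ?mxsum_norm_ge0 //.
  apply: le_trans (mxsum_normM _ _) _; rewrite -mulrA.
  by apply: ler_wpM2l.
apply: le_trans (mxsum_normM _ _) _; rewrite mulrAC.
by apply: ler_pM => //; apply: mxsum_norm_ge0.
Qed.

(** Below the critical spectral radius the zero feedback has a finite cost, which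
    does not involve the weight and bounds every [P s].  Since the Hessian is at
    least [s *: (B^T *m B)], the gain is of order [1 / s]. *)
Lemma gain_decay : spectral_radius A < (Num.sqrt gamma)^-1 ->
  exists2 K, 0 < K & forall s, 0 < s -> `|F s| <= K / s.
Proof.
move=> hA; set q := (Num.sqrt gamma)^-1 in hA.
have q0 : 0 < q by rewrite invr_gt0 sqrtr_gt0.
have gq : gamma * q ^+ 2 = 1.
  by rewrite exprVn sqr_sqrtr // mulfV // gt_eqF.
(* strictly between the moduli of the eigenvalues and 1 / sqrt gamma; the
   maximum with 0 keeps r positive in every case *)
pose r := (Num.max 0 (spectral_radius A) + q) / 2.
have [M0 Mq] : 0 <= Num.max 0 (spectral_radius A) /\ Num.max 0 (spectral_radius A) < q.
  by rewrite le_max lexx gt_max q0 hA.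
have Ms : spectral_radius A <= Num.max 0 (spectral_radius A) by rewrite le_max lexx orbT.
have r0 : 0 < r by rewrite /r; lra.
have rq : r < q by rewrite /r; lra.
have gr : gamma * r ^+ 2 < 1.
  by rewrite -gq ltr_pM2l // ltr_pXn2r // nnegrE ltW.
have [|S sS hS] := @discounted_lyapunov R r gamma n A Q r0 g0' gr.
  move=> z /le_spectral_radius h; apply: le_lt_trans h _.
  by rewrite /r; lra.
have [Kp Kp0 hKp] := mxsum_norm_quad S.
have [Ki Ki0 hKi] := mxsum_norm_inv BTB_spd.
pose K := gamma * (Ki * mxsum_norm B^T * Kp * mxsum_norm A).
have K0 : 0 <= K by rewrite /K !mulr_ge0 // mxsum_norm_ge0.
exists (K + 1) => [|s s0]; first by rewrite ltr_wpDl.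
have [sP eP] := riccati_spec (weight_spd s0).
have Ps : mxsum_norm (P s) <= Kp.
  rewrite -[Kp]mulr1; apply: hKp => // [|x]; first exact: sP.1.
  rewrite mul1r ger0_norm ?quad_ge0 //; last exact: spd_psd.
  apply: (riccati_le_supersolution (F := 0)) => // [|y]; first exact: weight_spd.
  by rewrite mul0mx quadv0 mulmx0 !addr0.
have Ms' : mxsum_norm (invmx (hess B gamma (W s) (P s))) <= Ki / s.
  have sH := hess_weight_spd s0; have uH := spd_unit sH.
  rewrite ler_pdivlMr // mulrC -{1}(gtr0_norm s0) -mxsum_normZ.
  have -> : s *: invmx (hess B gamma (W s) (P s)) = invmx (s^-1 *: hess B gamma (W s) (P s)).
    by rewrite invmxZ ?invrK // unitmxZ // unitfE invr_eq0 gt_eqF.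
  apply: hKi => [|x]; first by apply: spdZ; rewrite ?invr_gt0.
  have -> : quad (s^-1 *: hess B gamma (W s) (P s)) x
      = quad (B^T *m B) x + s^-1 * (gamma * quad (P s) (B *m x)).
    by rewrite quadZ quadD !quadZ quad_congr mulrDr mulKf // gt_eqF.
  rewrite lerDl !mulr_ge0 ?invr_ge0 ?(ltW s0) // quad_ge0 //.
  exact: spd_psd.
apply: le_trans (mx_norm_le_mxsum _) _.
apply: (@le_trans _ _ (K / s)); last by rewrite ler_pM2r ?invr_gt0 // lerDl.
rewrite /greedy mxsum_normZ normrN ger0_norm // /K -mulrA ler_wpM2l //.
have -> : Ki * mxsum_norm B^T * Kp * mxsum_norm A / s
    = Ki / s * mxsum_norm B^T * Kp * mxsum_norm A by ring.
by do 3!(apply: le_trans (mxsum_normM _ _) _; apply: ler_pM; rewrite ?mxsum_norm_ge0 //).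
Qed.

Lemma gain_FR rho : 0 < rho -> gain A B Q gamma FR rho%:M 1 = F (rho^-1).
Proof.
move=> r0; rewrite /gain /greedy /hess /=.
suff -> : B^T *m invmx rho%:M *m B = W rho^-1 by [].
by rewrite invmx_scalar mul_mx_scalar -scalemxAl.
Qed.

Lemma gain_KW rho : 0 < rho -> gain A B Q gamma KW rho%:M 1 = F ((rho + 1)^-1).
Proof.
move=> r0; rewrite /gain /greedy /hess /=.
suff -> : B^T *m invmx (rho%:M + 1%:M) *m B = W (rho + 1)^-1 by [].
by rewrite -raddfD invmx_scalar mul_mx_scalar -scalemxAl.
Qed.

Lemma gain_Otto Sigma : gain A B Q gamma Otto Sigma 1 = F 1.
Proof. by rewrite /gain /greedy /hess /= scale1r. Qed.

Lemma gain_KW_cvg_Otto Sigma :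
  gain A B Q gamma KW rho%:M 1 @[rho --> 0^'+] --> gain A B Q gamma Otto Sigma 1.
Proof.
have [K K0 hK] := gain_lipschitz.
apply/cvgrPdist_le => e e0; near=> rho.
have r0 : 0 < rho by near: rho; apply: nbhs_right_gt.
have re : rho <= e / K.
  by apply/ltW; near: rho; apply: nbhs_right_lt; rewrite divr_gt0.
have r10 : 0 < rho + 1 by rewrite addr_gt0.
rewrite gain_Otto gain_KW // distrC; apply: le_trans (hK _ _ _ _ _) _ => //.
- by rewrite invr_gt0.
- by rewrite invf_le1 // lerDr ltW.
rewrite divr1; apply: (@le_trans _ _ (K * rho)).
  rewrite ler_pM2l // lerBlDr -[1 in leLHS](mulfV (lt0r_neq0 r10)) mulrDl mul1r lerD2r.
  by rewrite ler_pdivrMr // ler_peMr ?lerDr // ltW.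
by rewrite mulrC -ler_pdivlMr.
Unshelve. all: by end_near. Qed.

Lemma gain_KW_FR_asymptotic :
  `|gain A B Q gamma KW rho%:M 1 - gain A B Q gamma FR rho%:M 1|
     @[rho --> +oo] --> (0 : R).
Proof.
have [K K0 hK] := gain_lipschitz.
apply/cvgrPdist_le => e e0; near=> rho.
have r1 : 1 <= rho by near: rho; apply: nbhs_pinfty_ge; rewrite num_real.
have r0 : 0 < rho by apply: lt_le_trans r1.
have re : K / e <= rho by near: rho; apply: nbhs_pinfty_ge; rewrite num_real.
have r10 : 0 < rho + 1 by rewrite addr_gt0.
rewrite sub0r normrN normr_id gain_FR // gain_KW //.
apply: le_trans (hK _ _ _ _ _) _.
- by rewrite invr_gt0.
- by rewrite lef_pV2 // lerDl.
- by rewrite invf_le1.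
have -> : 1 - (rho + 1)^-1 / rho^-1 = (rho + 1)^-1.
  by field; rewrite ?gt_eqF.
rewrite ler_pdivrMr //; move: re; rewrite ler_pdivrMr // mulrC => h.
by apply: le_trans h _; rewrite ler_pM2l // lerDl.
Unshelve. all: by end_near. Qed.

Lemma gain_FR_cvg0 : spectral_radius A < (Num.sqrt gamma)^-1 ->
  gain A B Q gamma FR rho%:M 1 @[rho --> 0^'+] --> (0 : 'M[R]_(m, n)).
Proof.
move=> /gain_decay[K K0 hK].
apply/cvgrPdist_le => e e0; near=> rho.
have r0 : 0 < rho by near: rho; apply: nbhs_right_gt.
have re : rho <= e / K.
  by apply/ltW; near: rho; apply: nbhs_right_lt; rewrite divr_gt0.
rewrite sub0r normrN gain_FR //; apply: le_trans (hK _ _) _; first by rewrite invr_gt0.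
by rewrite invrK mulrC -ler_pdivlMr.
Unshelve. all: by end_near. Qed.

End OptimalGain.

(** * The second moment of a centred normal law *)

Section NormalSecondMoment.
Context {R : realType}.
Local Notation mu := (@lebesgue_measure R).

(** The density is almost everywhere the Radon-Nikodym derivative of the law,
    since both have the same integral over every measurable set. *)
Lemma ge0_integral_normal_prob (m s : R) (f : R -> R) :
  measurable_fun setT f -> (forall x, 0 <= f x) ->
  (\int[normal_prob m s]_x (f x)%:E = \int[mu]_x (f x * normal_pdf m s x)%:E)%E.
Proof.
move=> mf f0.
have dom := normal_prob_dominates m s.
rewrite -(Radon_Nikodym_SigmaFinite.change_of_variables dom) //=; last exact/measurable_EFinP.
have RNm := measurable_int _ (Radon_Nikodym_SigmaFinite.f_integrable dom).
apply: ae_eq_integral => //=.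
- by apply: emeasurable_funM => //; exact/measurable_EFinP.
- apply/measurable_EFinP; apply: measurable_funM => //.
  exact: measurable_normal_pdf.
under [X in ae_eq _ _ _ X]eq_fun do rewrite EFinM.
apply: ae_eqe_mul2l; apply: integral_ae_eq => //=.
- exact: Radon_Nikodym_SigmaFinite.f_integrable.
- by apply/measurable_EFinP; exact: measurable_normal_pdf.
by move=> E _ mE; rewrite -(Radon_Nikodym_SigmaFinite.f_integral dom).
Qed.

Lemma is_derive_normal_pdf (s x : R) : s != 0 ->
  is_derive x 1 (normal_pdf 0 s) (- (x / s ^+ 2) * normal_pdf 0 s x).
Proof.
move=> s0; rewrite normal_pdfE //.
pose e : R -> R := (- (s ^+ 2 *+ 2)^-1) \*: (@idfun R ^+ 2).
have pE y : normal_fun 0 s y = expR (e y).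
  rewrite /normal_fun /e /= fctE /= /GRing.scale /= subr0; congr expR.
  by rewrite mulNr mulNr mulrC.
have -> : (fun y => normal_peak s * normal_fun 0 s y)
    = normal_peak s \*: (expR \o e).
  by apply/funext => y; rewrite pE.
have de : is_derive x 1 e (- (x / s ^+ 2)).
  apply: is_derive_eq.
  rewrite /= expr1 -mulr_natr /=.
  by rewrite /GRing.scale /=; field.
have := is_derive1_comp (is_derive_expR (e x)) de.
move=> dc; apply: is_derive_eq.
rewrite /GRing.scale /= pE; ring.
Qed.

(** Integration by parts of [x * (x pdf x)], [x pdf x] being the derivative of
    [- s^2 pdf x]. *)
Lemma normal_second_moment_upto (s : R) n : s != 0 ->
  (\int[mu]_(x in `[0%R, n.+1%:R]) (x ^+ 2 * normal_pdf 0 s x)%:E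
   = (s ^+ 2)%:E * \int[mu]_(x in `[0%R, n.+1%:R]) (normal_pdf 0 s x)%:E
     - (s ^+ 2 * (n.+1%:R * normal_pdf 0 s n.+1%:R))%:E)%E.
Proof.
move=> s0.
have cpdf := @continuous_normal_pdf R 0 s s0.
pose G := (- s ^+ 2) \*: normal_pdf 0 s.
have dG (x : R) : is_derive x 1 G (x * normal_pdf 0 s x).
  have dp := is_derive_normal_pdf x s0.
  apply: is_derive_eq.
  by rewrite /GRing.scale /=; field.
have cG : continuous G.
  by move=> x; apply: differentiable_continuous; apply/derivable1_diffP; have [] := dG x.
have LR (f : R -> R) : (forall x, derivable f x 1) -> derivable_oo_LRcontinuous f 0 n.+1%:R.
  move=> df; have cf x : f z @[z --> x] --> f x.
    by apply: differentiable_continuous; apply/derivable1_diffP.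
  by split=> [x _|| ] //; [apply: cvg_at_right_filter | apply: cvg_at_left_filter].
have E : (\int[mu]_(x in `[0%R, n.+1%:R]) (x * (x * normal_pdf 0 s x))%:E
    = (n.+1%:R * G n.+1%:R - 0 * G 0)%:E
      - \int[mu]_(x in `[0%R, n.+1%:R]) (1 * G x)%:E)%E.
  apply: (@integration_by_parts R id G (cst 1) (fun x => x * normal_pdf 0 s x)).
  - by rewrite ltr0n.
  - by apply: continuous_subspaceT => x; apply: cvg_cst.
  - by apply: LR.
  - by move=> x _; rewrite derive1E derive_id.
  - apply: continuous_subspaceT => x; apply: cvgM => //; exact: cpdf.
  - by apply: LR => x; have [] := dG x.
  - by move=> x _; rewrite derive1E; have [] := dG x.
under eq_integral do rewrite expr2 -mulrA.
rewrite E mul0r subr0.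
have -> : (\int[mu]_(x in `[0%R, n.+1%:R]) (1 * G x)%:E
   = - ((s ^+ 2)%:E * \int[mu]_(x in `[0%R, n.+1%:R]) (normal_pdf 0 s x)%:E))%E.
  under eq_integral do rewrite mul1r EFinM.
  rewrite integralZl //.
    by rewrite EFinN mulNe.
  apply: (integrableS measurableT) => //; exact: integrable_normal_pdf.
rewrite oppeK addeC; congr (_ + _)%E; rewrite -EFinN; congr EFin.
by rewrite /G /= /GRing.scale /=; ring.
Qed.

(** [expR y >= y] at [y = n^2 / (2 s^2)] already makes [n pdf n] of order [1/n]. *)
Lemma normal_pdf_tail (s : R) : s != 0 ->
  n.+1%:R * normal_pdf 0 s n.+1%:R @[n --> \oo] --> (0 : R).
Proof.
move=> s0; have s20 : 0 < s ^+ 2 *+ 2 by rewrite pmulrn_lgt0 // exprn_even_gt0.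
apply: (@squeeze_cvgr _ _ _ _ (fun=> 0) (fun n => normal_peak s * (s ^+ 2 *+ 2) * n.+1%:R^-1)).
- near=> n; rewrite mulr_ge0 ?normal_pdf_ge0 //= normal_pdfE // mulrCA -[leRHS]mulrA.
  rewrite ler_wpM2l ?normal_peak_ge0 //.
  pose y : R := n.+1%:R ^+ 2 / (s ^+ 2 *+ 2).
  have y0 : 0 < y by rewrite divr_gt0 // exprn_gt0.
  have -> : normal_fun 0 s n.+1%:R = (expR y)^-1.
    by rewrite /normal_fun subr0 mulNr expRN.
  apply: (@le_trans _ _ (n.+1%:R * y^-1)).
    rewrite ler_wpM2l // lef_pV2 ?posrE ?expR_gt0 //.
    by apply: le_trans (expR_ge1Dx y); rewrite lerDr.
  rewrite /y le_eqVlt; apply/orP; left; apply/eqP.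
  have N0 : (n.+1%:R : R) != 0 by rewrite pnatr_eq0.
  by move: (n.+1%:R : R) N0 => N N0; field; rewrite s0 N0.
- exact: cvg_cst.
- rewrite -[X in _ --> X](mulr0 (normal_peak s * (s ^+ 2 *+ 2))).
  by apply: cvgMr; apply: cvg_harmonic.
Unshelve. all: by end_near. Qed.

(** On the half-line the boundary term of [normal_second_moment_upto] vanishes in
    the limit, leaving [s^2] times the mass; evenness doubles both sides. *)
Lemma normal_prob_second_moment (s : R) : s != 0 ->
  (\int[normal_prob 0 s]_x (x ^+ 2)%:E = (s ^+ 2)%:E)%E.
Proof.
move=> s0; have cpdf := @continuous_normal_pdf R 0 s s0.
rewrite ge0_integral_normal_prob; last 2 first.
  exact: measurable_funX.
  by move=> x; rewrite sqr_ge0.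
have sym x : normal_pdf 0 s x = normal_pdf 0 s (- x).
  by rewrite !normal_pdfE // /normal_fun !subr0 sqrrN.
have cf : continuous (fun x : R => x ^+ 2 * normal_pdf 0 s x).
  by move=> x; apply: cvgM; [exact: exprn_continuous|exact: cpdf].
have f0 x : 0 <= x ^+ 2 * normal_pdf 0 s x.
  by rewrite mulr_ge0 ?sqr_ge0 ?normal_pdf_ge0.
rewrite ge0_symfun_integralT //; last by move=> x /=; rewrite sqrrN -sym.
have := integral_normal_pdf 0 s.
rewrite ge0_symfun_integralT //; last by move=> x; exact: normal_pdf_ge0.
have -> : [set x : R | 0 <= x] = `[0, +oo[%classic.
  by apply/seteqP; split => x/=; rewrite in_itv/= andbT.
move=> half.
suff -> : (\int[mu]_(x in `[0%R, +oo[) (x ^+ 2 * normal_pdf 0 s x)%:E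
    = (s ^+ 2)%:E * \int[mu]_(x in `[0%R, +oo[) (normal_pdf 0 s x)%:E)%E.
  by rewrite muleCA half mule1.
have mf := continuous_measurable_fun cf.
have h1 := @ge0_cvgn_integral R mu _ f0 mf.
have h2 := @ge0_cvgn_integral R mu _ (normal_pdf_ge0 0 s) (measurable_normal_pdf 0 s).
rewrite -cvg_shiftS in h1; rewrite -cvg_shiftS in h2.
suff h3 : (\int[mu]_(x in `[0%R, n.+1%:R]) (x ^+ 2 * normal_pdf 0 s x)%:E)%E
    @[n --> \oo] --> ((s ^+ 2)%:E
      * \int[mu]_(x in `[0%R, +oo[) (normal_pdf 0 s x)%:E)%E.
  exact: (cvg_unique _ h1 h3).
under eq_fun do rewrite normal_second_moment_upto //.
have tl : (s ^+ 2 * (n.+1%:R * normal_pdf 0 s n.+1%:R))%:E @[n --> \oo] --> 0%:E.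
  apply: cvg_EFin; first by near=> n.
  rewrite -[X in _ --> X](mulr0 (s ^+ 2)); apply: cvgMr.
  exact: normal_pdf_tail.
have h4 := cvgeZl (isT : (s ^+ 2)%:E \is a fin_num) h2.
have := cvgeB _ h4 tl; rewrite sube0; apply.
by rewrite fin_num_adde_defl.
Unshelve. all: by end_near. Qed.

End NormalSecondMoment.

(** * Second moments of Gaussian vectors *)

Section Means.
Context {R : realType} {d : measure_display} {Omega : measurableType d}.
Context (Pr : probability Omega R).
Implicit Types (f g : Omega -> R) (a b : R).

(** Integrability is part of the notion: means can then be added. *)
Definition has_mean f a : Prop :=
  Pr.-integrable setT (EFin \o f) /\ (\int[Pr]_om (f om)%:E = a%:E)%E.

Lemma has_meanD f g a b :
  has_mean f a -> has_mean g b -> has_mean (fun om => f om + g om) (a + b).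
Proof.
move=> [intf fa] [intg gb]; split; first exact: (integrableD measurableT intf intg).
by under eq_integral do rewrite EFinD; rewrite integralD // fa gb.
Qed.

Lemma has_meanZ k f a : has_mean f a -> has_mean (fun om => k * f om) (k * a).
Proof.
move=> [intf fa]; split; first exact: (integrableZl measurableT k intf).
by under eq_integral do rewrite EFinM; rewrite integralZl // fa.
Qed.

Lemma has_mean0 : has_mean (fun=> 0) 0.
Proof. by split; [exact: integrable0 | rewrite integral0]. Qed.

Lemma has_mean_sum (I : Type) (r : seq I) (f : I -> Omega -> R) (a : I -> R) :
  (forall i, has_mean (f i) (a i)) ->
  has_mean (fun om => \sum_(i <- r) f i om) (\sum_(i <- r) a i).
Proof.
move=> hf; elim: r => [|i r IH].
  by rewrite big_nil; under eq_fun do rewrite big_nil; apply: has_mean0.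
by rewrite big_cons; under eq_fun do rewrite big_cons; apply: has_meanD.
Qed.

Lemma has_mean_ge0 f a : (forall om, 0 <= f om) -> has_mean f a -> 0 <= a.
Proof.
by move=> f0 [_ fa]; rewrite -lee_fin -fa; apply: integral_ge0 => om _; rewrite lee_fin.
Qed.

Lemma has_mean_measurable f a : has_mean f a -> measurable_fun setT f.
Proof. by move=> [/measurable_int /measurable_EFinP]. Qed.

Lemma has_mean_ge0I f a : measurable_fun setT f -> (forall om, 0 <= f om) ->
  (\int[Pr]_om (f om)%:E = a%:E)%E -> has_mean f a.
Proof.
move=> mf f0 fa; split=> //; apply/integrableP; split; first exact/measurable_EFinP.
by under eq_integral do rewrite /= ger0_norm //; rewrite fa ltry.
Qed.

Lemma eq_measurable_law (X : Omega -> measurableTypeR R)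
    (nu : {measure set (measurableTypeR R) -> \bar R})
    (f : R -> R) :
  measurable_fun setT X -> measurable_fun setT f -> (forall x, 0 <= f x) ->
  (forall V, measurable V -> Pr [set om | V (X om)] = nu V) ->
  (\int[Pr]_om (f (X om))%:E = \int[nu]_x (f x)%:E)%E.
Proof.
move=> mX mf f0 law.
pose X' : {mfun Omega >-> measurableTypeR R} :=
  HB.pack X (isMeasurableFun.Build _ _ _ _ X mX).
have mf' : measurable_fun setT (fun x => (f x)%:E) by exact/measurable_EFinP.
rewrite -[LHS](ge0_integral_distribution X' mf') //.
by apply: eq_measure_integral => V mV _; apply: law.
Qed.

(** The pairs [(X, Y)] and [(- X, Y)] have the same law, because it is the product
    of the marginal laws and [X] is symmetric.  Hence [X Y] and [- X Y] have the
    same mean. *)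
Lemma mean_mul_independent (X Y : Omega -> R) :
  measurable_fun setT X -> measurable_fun setT Y ->
  (forall V, measurable V -> Pr (X @^-1` V) = Pr ((fun om => - X om) @^-1` V)) ->
  (forall U V, measurable U -> measurable V ->
     Pr (X @^-1` U `&` Y @^-1` V) = (Pr (X @^-1` U) * Pr (Y @^-1` V))%E) ->
  Pr.-integrable setT (fun om => (X om * Y om)%:E) ->
  has_mean (fun om => X om * Y om) 0.
Proof.
move=> mX mY symX indXY intXY; split=> //.
have mN : measurable_fun setT (fun om => - X om) by exact: measurable_funN.
have mp1 : measurable_fun setT (fun om => (X om, Y om)) by exact: measurable_fun_pair.
have mp2 : measurable_fun setT (fun om => (- X om, Y om)) by exact: measurable_fun_pair.
pose X' : {mfun Omega >-> R} := HB.pack X (isMeasurableFun.Build _ _ _ _ X mX).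
pose Y' : {mfun Omega >-> R} := HB.pack Y (isMeasurableFun.Build _ _ _ _ Y mY).
pose p1 : {mfun Omega >-> (R * R)%type} :=
  HB.pack (fun om => (X om, Y om)) (isMeasurableFun.Build _ _ _ _ _ mp1).
pose p2 : {mfun Omega >-> (R * R)%type} :=
  HB.pack (fun om => (- X om, Y om)) (isMeasurableFun.Build _ _ _ _ _ mp2).
pose h (z : R * R) : \bar R := (z.1 * z.2)%:E.
have mh : measurable_fun setT h.
  by apply/measurable_EFinP; apply: measurable_funM; [exact: measurable_fst|exact: measurable_snd].
have same : (\int[distribution Pr p1]_z h z = \int[distribution Pr p2]_z h z)%E.
  apply: eq_measure_integral => V mV _.
  transitivity ((distribution Pr X' \x distribution Pr Y')%E V).
    by apply/esym; apply: product_measure_unique.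
  apply: product_measure_unique => // U W mU mW.
  have mNU : measurable [set x : R | U (- x)].
    by rewrite -[X in measurable X]setTI; apply: (@measurable_funN _ _ R setT id).
  rewrite -[RHS]/((Pr (X @^-1` U) * Pr (Y @^-1` W))%E) (symX U mU).
  exact: (indXY _ _ mNU mW).
rewrite !integral_distribution //= in same; last first.
  rewrite /comp /h /=; under eq_fun do rewrite mulNr EFinN.
  exact: integrableN.
move: same; rewrite /h /=.
under [X in _ = X]eq_integral do rewrite mulNr EFinN.
rewrite integralN //; last first.
  apply: integrable_add_def => //.
have : (\int[Pr]_om (X om * Y om)%:E)%E \is a fin_num by apply: integrable_fin_num.
move/fineK => <-; rewrite -EFinN => -[e]; congr EFin; lra.
Qed.

End Means.

Section RandomVectors.
Context {R : realType} {d : measure_display} {Omega : measurableType d}.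
Context (Pr : probability Omega R).

Definition lin n (c v : 'cV[R]_n) : R := (c^T *m v) 0 0.

Lemma lin_continuous n (c : 'cV[R]_n) : continuous (lin c).
Proof.
have -> : lin c = (fun v => \sum_i c i 0 * v i 0).
  by apply/funext => v; rewrite /lin mxE; apply: eq_bigr => i _; rewrite mxE.
move=> v; apply: (@cvg_big _ _ _ _ _ add_continuous _ (nbhs v) _ _ _ (nbhs_filter v)) => i _.
apply: cvgM; first exact: cvg_cst.
exact: coord_continuous.
Qed.

(** [lin c] is continuous and the half-lines, which are open, generate the Borel
    sets of the line. *)
Lemma borel_lin n (c : 'cV[R]_n) (V : set R) :
  measurable V -> borel [set v | V (lin c v)].
Proof.
move=> mV.
have mlin : measurable_fun setT
    (lin c : g_sigma_algebraType (@open 'cV[R]_n) -> R).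
  apply: (measurability _ (RGenOInfty.measurableE R)) => _ [_ [a ->] <-].
  rewrite setTI; apply: sub_sigma_algebra.
  apply: open_comp; first by move=> v _; apply: lin_continuous.
  exact: interval_open.
by have := mlin measurableT V mV; rewrite setTI.
Qed.

Lemma random_vector_lin n (X : Omega -> 'cV[R]_n) (c : 'cV[R]_n) :
  random_vector X -> measurable_fun setT (fun om => lin c (X om)).
Proof.
move=> rX _ V mV; rewrite setTI; apply: (rX [set v | V (lin c v)]).
exact: borel_lin.
Qed.

Lemma lin_delta n (v : 'cV[R]_n) i : lin (delta_mx i 0) v = v i 0.
Proof. by rewrite /lin trmx_delta -rowE mxE. Qed.

Lemma lin_addl n (b c v : 'cV[R]_n) : lin (b + c) v = lin b v + lin c v.
Proof. by rewrite /lin linearD /= mulmxDl mxE. Qed.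

(** A functional of variance 0 has a Dirac law, which is treated apart. *)
Lemma gaussian_lin_second_moment n (X : Omega -> 'cV[R]_n) S c :
  psd S -> gaussian_vector Pr X 0 S ->
  has_mean Pr (fun om => lin c (X om) ^+ 2) (quad S c).
Proof.
move=> sS [rX law].
have mX := random_vector_lin c rX.
have msq : measurable_fun setT (fun x : R => x ^+ 2) by exact: measurable_funX.
apply: has_mean_ge0I => [|om|].
- exact: (measurableT_comp msq mX).
- exact: sqr_ge0.
have [S0|S0] := eqVneq (quad S c) 0.
  rewrite (@eq_measurable_law _ _ _ Pr _ (\d_(0 : measurableTypeR R)) (fun x => x ^+ 2)) //.
  - rewrite integral_dirac //; last exact/measurable_EFinP.
    by rewrite diracT mul1e expr0n S0.
  - by move=> x; exact: sqr_ge0.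
  move=> V mV; rewrite (law c V mV) /normal_law S0 eqxx.
  by rewrite mulmx0 mxE.
have sS0 : Num.sqrt (quad S c) != 0.
  by rewrite sqrtr_eq0 -ltNge lt_def S0 quad_ge0.
rewrite (@eq_measurable_law _ _ _ Pr _ (normal_prob 0 (Num.sqrt (quad S c))) (fun x => x ^+ 2)) //.
- by rewrite normal_prob_second_moment // sqr_sqrtr // quad_ge0.
- by move=> x; exact: sqr_ge0.
by move=> V mV; rewrite (law c V mV) /normal_law (negbTE S0) mulmx0 mxE.
Qed.

(** The entries of the matrix E[X Y^T]. *)
Definition cross_moment n p (X : Omega -> 'cV[R]_n) (Y : Omega -> 'cV[R]_p)
    (C : 'M[R]_(n, p)) : Prop :=
  forall i j, has_mean Pr (fun om => X om i 0 * Y om j 0) (C i j).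

Lemma cross_momentD n p (X X' : Omega -> 'cV[R]_n) (Y : Omega -> 'cV[R]_p) C C' :
  cross_moment X Y C -> cross_moment X' Y C' ->
  cross_moment (fun om => X om + X' om) Y (C + C').
Proof.
move=> h h' i j; rewrite mxE; under eq_fun do rewrite mxE mulrDl.
exact: has_meanD.
Qed.

Lemma cross_momentM n p q (M : 'M[R]_(q, n)) (X : Omega -> 'cV[R]_n)
    (Y : Omega -> 'cV[R]_p) C :
  cross_moment X Y C -> cross_moment (fun om => M *m X om) Y (M *m C).
Proof.
move=> h i j; rewrite mxE.
under eq_fun do rewrite mxE big_distrl /=.
apply: has_mean_sum => k; under eq_fun do rewrite -mulrA.
exact: has_meanZ.
Qed.

Lemma cross_momentC n p (X : Omega -> 'cV[R]_n) (Y : Omega -> 'cV[R]_p) C :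
  cross_moment X Y C -> cross_moment Y X C^T.
Proof. by move=> h i j; rewrite mxE; under eq_fun do rewrite mulrC; apply: h. Qed.

Lemma mean_quad n (D S : 'M[R]_n) (X : Omega -> 'cV[R]_n) :
  cross_moment X X S -> has_mean Pr (fun om => quad D (X om)) (\tr (D *m S^T)).
Proof.
move=> h; rewrite /mxtrace; under eq_fun do rewrite quadE.
apply: has_mean_sum => i; rewrite mxE.
apply: has_mean_sum => j; rewrite mxE; exact: has_meanZ.
Qed.

(** The law of the vector is given through its linear functionals; mixed moments
    are recovered from the squares of [X_i + X_j], [X_i] and [X_j]. *)
Lemma gaussian_second_moment n (X : Omega -> 'cV[R]_n) S :
  psd S -> gaussian_vector Pr X 0 S -> cross_moment X X S.
Proof.
move=> sS gX i j; rewrite (mx_entry_polarization _ _ sS.1).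
have h c := gaussian_lin_second_moment c sS gX.
have := has_meanZ 2^-1 (has_meanD (h (delta_mx i 0 + delta_mx j 0))
  (has_meanD (has_meanZ (-1) (h (delta_mx i 0))) (has_meanZ (-1) (h (delta_mx j 0))))).
rewrite !mulN1r addrA mulrC.
under eq_fun do rewrite lin_addl !lin_delta.
rewrite (_ : (fun om => _) = (fun om => X om i 0 * X om j 0)) //.
by apply/funext => om; field.
Qed.

(** The coordinates of a centred Gaussian vector are symmetric, since the law of
    [lin c X] depends on [c] through [quad S c] only. *)
Lemma gaussian_cross_moment n (Z : nat -> Omega -> 'cV[R]_n) a b S T :
  mutually_independent Pr Z -> a != b -> psd S -> psd T ->
  gaussian_vector Pr (Z a) 0 S -> gaussian_vector Pr (Z b) 0 T ->
  cross_moment (Z a) (Z b) 0.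
Proof.
move=> ind ab sS sT gA gB i j; rewrite mxE.
have [rA lawA] := gA; have [rB lawB] := gB.
have eqlin (Y : Omega -> 'cV[R]_n) k : (fun om => Y om k 0) = (fun om => lin (delta_mx k 0) (Y om)).
  by apply/funext => om; rewrite lin_delta.
have mA : measurable_fun setT (fun om => Z a om i 0).
  by rewrite eqlin; apply: random_vector_lin.
have mB : measurable_fun setT (fun om => Z b om j 0).
  by rewrite eqlin; apply: random_vector_lin.
apply: mean_mul_independent => //.
- move=> V mV.
  have := lawA (delta_mx i 0) V mV; have := lawA (- delta_mx i 0) V mV.
  rewrite !mulmx0 mxE -scaleN1r quad_scale sqrrN expr1n mul1r => <-.
  rewrite /preimage => h.
  transitivity (Pr [set om | V (((delta_mx i 0 : 'cV[R]_n)^T *m Z a om) 0 0)]).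
    by congr (Pr _); apply/seteqP; split=> om /=; rewrite -/(lin _ _) lin_delta.
  rewrite h; congr (Pr _); apply/seteqP; split=> om /=.
    by rewrite linearZ /= -scalemxAl mxE -/(lin _ _) lin_delta mulN1r.
  by rewrite linearZ /= -scalemxAl mxE -/(lin _ _) lin_delta mulN1r.
- move=> U V mU mV.
  pose W k : set 'cV[R]_n := if k == a then [set v | U (lin (delta_mx i 0) v)]
    else [set v | V (lin (delta_mx j 0) v)].
  have bW k : borel (W k) by rewrite /W; case: ifP => _; apply: borel_lin.
  have uab : uniq [:: a; b] by rewrite /= inE ab.
  have := ind [:: a; b] W uab bW.
  rewrite !big_cons big_nil mule1 /W eqxx eq_sym (negbTE ab).
  have eA : Z a @^-1` [set v | U (lin (delta_mx i 0) v)] = (fun om => Z a om i 0) @^-1` U.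
    by rewrite eqlin.
  have eB : Z b @^-1` [set v | V (lin (delta_mx j 0) v)] = (fun om => Z b om j 0) @^-1` V.
    by rewrite eqlin.
  rewrite eA eB => <-; congr (Pr _); apply/seteqP; split=> om /=.
    move=> [hU hV] k; rewrite /= !inE => /orP[] /eqP ->.
      by rewrite eqxx /= lin_delta.
    by rewrite eq_sym (negbTE ab) /= lin_delta.
  move=> h; split.
    by have := h a; rewrite /= !inE eqxx /= lin_delta; apply.
  by have := h b; rewrite /= !inE eqxx orbT eq_sym (negbTE ab) /= lin_delta; apply.
have [iA _] := gaussian_second_moment sS gA i i.
have [iB _] := gaussian_second_moment sT gB j j.
apply: (le_integrable _ _ _ (integrableD measurableT iA iB)) => //.
  by apply/measurable_EFinP; apply: measurable_funM.
move=> om _ /=; rewrite lee_fin normrM.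
rewrite [leRHS]ger0_norm; last by rewrite addr_ge0 // -expr2 sqr_ge0.
have := sqr_ge0 (`|Z a om i 0| - `|Z b om j 0|).
rewrite -!expr2 -(real_normK (num_real (Z a om i 0))) -(real_normK (num_real (Z b om j 0))).
have := normr_ge0 (Z a om i 0); have := normr_ge0 (Z b om j 0).
move: `|_| `|_| => x y; nra.
Qed.

End RandomVectors.

(** * Optimality of the Riccati gain *)

Section SeriesComparison.
Context {R : realType}.
Implicit Types u v : nat -> R.

(** A series with bounded partial sums has the same value in the extended reals
    as in the reals. *)
Lemma nneseries_bounded u M : (forall t, 0 <= u t) ->
  (forall T, \sum_(0 <= t < T) u t <= M) ->
  exists2 l, \sum_(0 <= t < T) u t @[T --> \oo] --> l
    & (\sum_(0 <= t <oo) (u t)%:E = l%:E)%E.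
Proof.
move=> u0 uM.
have cu : cvgn (fun T => \sum_(0 <= t < T) u t).
  apply: nondecreasing_is_cvgn; last by exists M => _ [T _ <-].
  by apply/nondecreasing_seqP => T; rewrite big_nat_recr //= lerDl.
exists (limn (fun T => \sum_(0 <= t < T) u t)) => //.
apply/cvg_lim => //; under eq_fun do rewrite sumEFin.
by apply: cvg_EFin => //; near=> T.
Unshelve. all: by end_near. Qed.

(** If the second sum is finite, then its terms tend to 0 and the margin [e]
    survives in the limit; otherwise there is nothing to prove, the first sum
    being finite. *)
Lemma nneseries_lt u v M C e : (forall t, 0 <= u t) -> (forall t, 0 <= v t) ->
  (forall T, \sum_(0 <= t < T) u t <= M) -> 0 < e ->
  (forall T, (1 < T)%N ->
     \sum_(0 <= t < T) u t + e <= \sum_(0 <= t < T) v t + C * v T) ->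
  (\sum_(0 <= t <oo) (u t)%:E < \sum_(0 <= t <oo) (v t)%:E)%E.
Proof.
move=> u0 v0 uM e0 uv; have [l ul ->] := nneseries_bounded u0 uM.
have v0' t : (0 <= (v t)%:E)%E by rewrite lee_fin.
have [vy|] := eqVneq (\sum_(0 <= t <oo) (v t)%:E)%E +oo%E; first by rewrite vy ltry.
move=> vy; have vfin : (\sum_(0 <= t <oo) (v t)%:E)%E \is a fin_num.
  by rewrite ge0_fin_numE ?lt_neqAle ?vy ?leey // nneseries_ge0.
have vM T : \sum_(0 <= t < T) v t <= fine (\sum_(0 <= t <oo) (v t)%:E)%E.
  rewrite -lee_fin fineK // -sumEFin; exact: nneseries_lim_ge.
have [k vk ->] := nneseries_bounded v0 vM.
have vT0 : v T @[T --> \oo] --> 0 by apply: cvg_series_cvg_0; apply: cvgP vk.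
rewrite lte_fin; apply: (@lt_le_trans _ _ (l + e)); first by rewrite ltrDl.
have h1 : \sum_(0 <= t < T) u t + e @[T --> \oo] --> l + e.
  by apply: cvgD => //; apply: cvg_cst.
have h2 : \sum_(0 <= t < T) v t + C * v T @[T --> \oo] --> k + C * 0.
  by apply: cvgD => //; apply: cvgMr.
rewrite mulr0 addr0 in h2.
apply: ler_cvg_to h1 h2 _; near=> T; apply: uv.
by near: T; exists 2%N.
Unshelve. all: by end_near. Qed.

End SeriesComparison.

Section Cost.
Context {R : realType} (n m : nat) (A : 'M[R]_n) (B : 'M[R]_(n, m)).
Context (Q : 'M[R]_n) (gamma : R) (o : geometry) (Sigma_w : 'M[R]_n) (lambda : R).
Context (sysA : system_assumptions A B Q gamma).
Context (sSw : spd Sigma_w).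
Context (lambda0 : 0 < lambda).

Local Notation W := (control_weight B o Sigma_w lambda).

Lemma control_weight_spd : spd W.
Proof.
have injB : forall v : 'cV_m, v != 0 -> B *m v != 0.
  by apply: mxrank_inj; case: sysA.
case: o => /=.
- exact: spd_congr injB (spd_inv sSw).
- by rewrite -[B^T]mulmx1; apply: spd_congr injB (spd1 _).
apply: spd_congr injB (spd_inv _); apply: spdD_psd sSw _.
by rewrite -scalemx1; apply: psdZ (ltW lambda0) (spd_psd (spd1 _)).
Qed.

Lemma divergence_transition x u :
  divergence o lambda (transition A B Sigma_w x u) (transition A B Sigma_w x 0)
  = 2^-1 * quad W u.
Proof.
rewrite /divergence /transition /= mulmx0 addr0 addrAC subrr add0r.
by case: o => /=; rewrite ?quad_congr // /quad trmx_mul !mulmxA.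
Qed.

Context {d : measure_display} {Omega : measurableType d}.
Context (Pr : probability Omega R) (Sigma_0 : 'M[R]_n).
Context (x0 : Omega -> 'cV[R]_n) (w : nat -> Omega -> 'cV[R]_n).
Context (sS0 : psd Sigma_0).
Context (law : initial_and_noise Pr x0 w Sigma_0 Sigma_w).
Implicit Types (F G : 'M[R]_(m, n)) (D : 'M[R]_n).

Fixpoint state_covariance F t : 'M[R]_n :=
  if t is s.+1
  then (A + B *m F) *m state_covariance F s *m (A + B *m F)^T + Sigma_w
  else Sigma_0.

(** The expectation of [quad D] at the state of time [t], see
    [mean_quad_trajectory]. *)
Definition mean_form F t D : R := \tr (D *m (state_covariance F t)^T).

Lemma trajectoryS F t om : trajectory A B F x0 w t.+1 om
  = (A + B *m F) *m trajectory A B F x0 w t om + w t om.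
Proof. by rewrite /= mulmxDl -mulmxA. Qed.

(** The state at time [t] is a linear function of the initial state and of the
    noise before time [t], both independent of the later noise. *)
Lemma trajectory_noise_uncorrelated F t s : (t <= s)%N ->
  cross_moment Pr (trajectory A B F x0 w t) (w s) 0.
Proof.
have [gx gw ind] := law; have sSw' := spd_psd sSw.
elim: t s => [|t IH] s ts.
  exact: (gaussian_cross_moment (a := 0%N) (b := s.+1) ind _ sS0 sSw' gx (gw s)).
have -> : trajectory A B F x0 w t.+1
    = (fun om => (A + B *m F) *m trajectory A B F x0 w t om + w t om).
  by apply/funext => om; rewrite trajectoryS.
rewrite -[0]addr0 -{1}(mulmx0 _ (A + B *m F)); apply: cross_momentD.
  by apply: cross_momentM; apply: IH; apply: ltnW.
apply: (gaussian_cross_moment (a := t.+1) (b := s.+1) ind _ sSw' sSw' (gw t) (gw s)).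
by rewrite eqSS neq_ltn ts.
Qed.

Lemma trajectory_second_moment F t :
  cross_moment Pr (trajectory A B F x0 w t) (trajectory A B F x0 w t)
    (state_covariance F t).
Proof.
have [gx gw ind] := law; have sSw' := spd_psd sSw.
elim: t => [|t IH]; first exact: gaussian_second_moment.
have -> : trajectory A B F x0 w t.+1
    = (fun om => (A + B *m F) *m trajectory A B F x0 w t om + w t om).
  by apply/funext => om; rewrite trajectoryS.
rewrite /=; set Ac := A + B *m F; set X := trajectory A B F x0 w t.
have hXw : cross_moment Pr X (w t) 0 by apply: trajectory_noise_uncorrelated.
have hww : cross_moment Pr (w t) (w t) Sigma_w.
  exact: (gaussian_second_moment sSw' (gw t)).
have h1 : cross_moment Pr (fun om => Ac *m X om + w t om) X (Ac *m state_covariance F t).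
  rewrite -[Ac *m _]addr0; apply: cross_momentD; first exact: cross_momentM.
  by rewrite -[0]trmx0; apply: cross_momentC.
have h2 : cross_moment Pr (fun om => Ac *m X om + w t om) (w t) Sigma_w.
  rewrite -[Sigma_w]add0r -{1}(mulmx0 _ Ac); apply: cross_momentD => //.
  exact: cross_momentM.
have := cross_momentD (cross_momentM Ac (cross_momentC h1)) (cross_momentC h2).
move=> /cross_momentC; rewrite linearD /= !trmxK trmx_mul trmxK; exact.
Qed.

Lemma mean_quad_trajectory F t D :
  has_mean Pr (fun om => quad D (trajectory A B F x0 w t om)) (mean_form F t D).
Proof. exact: mean_quad (trajectory_second_moment F t). Qed.

Lemma mean_formD F t D D' : mean_form F t (D + D') = mean_form F t D + mean_form F t D'.
Proof. by rewrite /mean_form mulmxDl linearD. Qed.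

Lemma mean_formZ F t a D : mean_form F t (a *: D) = a * mean_form F t D.
Proof. by rewrite /mean_form -scalemxAl linearZ. Qed.

Lemma mean_form_le F t D D' : (forall x, quad D x <= quad D' x) ->
  mean_form F t D <= mean_form F t D'.
Proof.
move=> DD'; rewrite -subr_ge0 -mulN1r -mean_formZ -mean_formD.
apply: has_mean_ge0 (mean_quad_trajectory F t _) => om.
by rewrite quadD scaleN1r quadN subr_ge0.
Qed.

Lemma mean_form_ge0 F t D : (forall x, 0 <= quad D x) -> 0 <= mean_form F t D.
Proof. by move=> D0; apply: has_mean_ge0 (mean_quad_trajectory F t _) => om. Qed.

Lemma mean_formS F t D : mean_form F t.+1 D
  = mean_form F t ((A + B *m F)^T *m D *m (A + B *m F)) + \tr (D *m Sigma_w).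
Proof.
rewrite /mean_form /= linearD /= sSw.1 mulmxDr linearD /=; congr (_ + _).
by rewrite !trmx_mul trmxK !mulmxA mxtrace_mulC !mulmxA.
Qed.

(** The trace is the mean of the form [H] at [N w_0], where [w_0] is the noise.  By
    coercivity it is at least a multiple of the sum of the variances of the
    coordinates of [N w_0], one of which is positive. *)
Lemma trace_noise_gt0 p (N : 'M[R]_(p, n)) (H : 'M[R]_p) : spd H -> N != 0 ->
  0 < \tr (N^T *m H *m N *m Sigma_w).
Proof.
move=> sH N0; have [_ gw _] := law; have sSw' := spd_psd sSw.
have [K K0 hK] := spd_coercive sH.
have [[i j] Nij] : exists ij, N ij.1 ij.2 != 0.
  apply/existsP; apply: contraNT N0; rewrite negb_exists => /forallP N0.
  by apply/eqP/matrixP => i j; have := N0 (i, j); rewrite negbK mxE => /eqP.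
pose c k := (row k N)^T.
have mean1 := mean_quad (N^T *m H *m N) (gaussian_second_moment sSw' (gw 0%N)).
rewrite sSw.1 in mean1.
have mean2 : has_mean Pr (fun om => \sum_k lin (c k) (w 0%N om) ^+ 2)
    (\sum_k quad Sigma_w (c k)).
  by apply: has_mean_sum => k; apply: gaussian_lin_second_moment.
have lb : 0 <= K * \tr (N^T *m H *m N *m Sigma_w) + -1 * \sum_k quad Sigma_w (c k).
  apply: has_mean_ge0 (has_meanD (has_meanZ K mean1) (has_meanZ (-1) mean2)) => om.
  rewrite mulN1r subr_ge0 quad_congr; apply: le_trans (hK _).
  rewrite sqnormE le_eqVlt; apply/orP; left; apply/eqP/eq_bigr => k _.
  by rewrite /lin /c trmxK -row_mul [in LHS]mxE.
have pos : 0 < \sum_k quad Sigma_w (c k).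
  rewrite (bigD1 i) //= ltr_pwDl //.
    apply: sSw.2; rewrite trmx_eq0; apply: contraNneq Nij => /matrixP/(_ 0 j).
    by rewrite !mxE => ->.
  by apply: sumr_ge0 => k _; apply: quad_ge0.
rewrite -(pmulr_rgt0 _ K0); apply: lt_le_trans pos _.
by rewrite mulN1r subr_ge0 in lb.
Qed.

Lemma costE F : cost Pr o lambda A B Q gamma Sigma_w x0 w F
  = (\sum_(0 <= t <oo) (2^-1 * (gamma ^+ t * mean_form F t (Q + F^T *m W *m F)))%:E)%E.
Proof.
have [sQ _ _ _ /andP[g0 _]] := sysA.
rewrite /cost.
pose f t om := 2^-1 * gamma ^+ t * quad (Q + F^T *m W *m F) (trajectory A B F x0 w t om).
have hf t : has_mean Pr (f t) (2^-1 * gamma ^+ t * mean_form F t (Q + F^T *m W *m F)).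
  exact: has_meanZ (mean_quad_trajectory F t _).
transitivity (\int[Pr]_om \sum_(0 <= t <oo) (f t om)%:E)%E.
  apply: eq_integral => om _; apply: eq_eseriesr => t _; congr EFin.
  rewrite divergence_transition /f quadD quad_congr; ring.
rewrite integral_nneseries //.
- by apply: eq_eseriesr => t _; rewrite (hf t).2 mulrA.
- by move=> t; apply/measurable_EFinP; apply: has_mean_measurable (hf t).
move=> t om _; rewrite lee_fin mulr_ge0 ?mulr_ge0 ?invr_ge0 ?exprn_ge0 ?(ltW g0) //.
rewrite quadD quad_congr addr_ge0 ?quad_ge0 //; apply: spd_psd => //.
exact: control_weight_spd.
Qed.

(** Both costs are compared through the telescoped identity [total].  The
    feedback [F] has no excess [E], while that of [G] is already positive at time
    1, whatever the initial covariance. *)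
Lemma gain_unique_minimizer :
  unique_minimizer (cost Pr o lambda A B Q gamma Sigma_w x0 w)
    (gain A B Q gamma o Sigma_w lambda).
Proof.
move=> G GF; set F := gain _ _ _ _ _ _ _ in GF *.
have [sQ _ _ _ /andP[g0 g1]] := sysA; have g0' := ltW g0.
have sW := control_weight_spd; have sW' := spd_psd sW.
have [sP eP] := riccati_spec sysA sW.
move: (riccati A B Q gamma W) sP eP (erefl : F = greedy A B gamma W (riccati A B Q gamma W)).
move=> P sP eP eF; have sP' := spd_psd sP.
have sH := hess_spd B g0' sW sP'; set H := hess B gamma W P in sH *.
pose N K := Q + K^T *m W *m K.
pose E K := (K - F)^T *m H *m (K - F).
have N0 K x : 0 <= quad (N K) x.
  by rewrite quadD quad_congr addr_ge0 ?quad_ge0 //; apply: spd_psd.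
have E0 K x : 0 <= quad (E K) x by rewrite quad_congr quad_ge0 //; apply: spd_psd.
have NPE K : N K + gamma *: ((A + B *m K)^T *m P *m (A + B *m K)) = P + E K.
  apply: quad_inj => [||x].
  - exact: (psdD (psdD (spd_psd sQ) (psd_congr _ sW')) (psdZ g0' (psd_congr _ sP'))).1.
  - exact: (psdD sP' (psd_congr _ (spd_psd sH))).1.
  rewrite !quadD quadZ !quad_congr mulmxDl -mulmxA.
  rewrite (bellman_square A B Q x (K *m x) g0' sW sP') eP -eF.
  by rewrite mulmxBl.
pose c := \tr (P *m Sigma_w).
have step K t : mean_form K t (N K) + gamma * mean_form K t.+1 P
    = mean_form K t P + mean_form K t (E K) + gamma * c.
  rewrite -mean_formD -NPE mean_formD mean_formZ mean_formS; ring.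
have total K T : \sum_(0 <= t < T) gamma ^+ t * mean_form K t (N K)
      + gamma ^+ T * mean_form K T P
    = mean_form K 0 P + \sum_(0 <= t < T) gamma ^+ t * (mean_form K t (E K) + gamma * c).
  elim: T => [|T IH]; first by rewrite !big_nil expr0 mul1r add0r addr0.
  rewrite !big_nat_recr //= addrA -IH exprS.
  have := congr1 (fun z => gamma ^+ T * z) (step K T).
  rewrite !mulrDr; lra.
(* the boundary term of the telescoped sum is controlled by the last cost *)
have [C C0 hC] := quad_dominated P sQ.
have pq K t : mean_form K t P <= C * mean_form K t (N K).
  rewrite -mean_formZ; apply: mean_form_le => x; apply: le_trans (hC x) _.
  by rewrite quadZ ler_wpM2l ?(ltW C0) // quadD lerDl quad_congr quad_ge0.
have EF t : mean_form F t (E F) = 0.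
  by rewrite /E subrr mulmx0 /mean_form mul0mx mxtrace0.
have c0 : 0 <= c.
  have [_ gw _] := law; have := mean_quad P (gaussian_second_moment (spd_psd sSw) (gw 0%N)).
  by rewrite sSw.1; apply: has_mean_ge0 => om; apply: quad_ge0.
rewrite !costE.
have nn K t : 0 <= gamma ^+ t * mean_form K t (N K).
  by rewrite mulr_ge0 ?exprn_ge0 // mean_form_ge0.
have e1 : 0 < mean_form G 1 (E G).
  rewrite mean_formS ltr_wpDl //.
    by apply: mean_form_ge0 => x; rewrite quad_congr.
  by apply: trace_noise_gt0 => //; rewrite subr_eq0; apply/eqP.
have pge0 K t : 0 <= gamma ^+ t * mean_form K t P.
  by rewrite mulr_ge0 ?exprn_ge0 // mean_form_ge0 // => x; apply: quad_ge0.
have half z : \sum_(0 <= t < z) 2^-1 * (gamma ^+ t * mean_form F t (N F))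
    = 2^-1 * \sum_(0 <= t < z) gamma ^+ t * mean_form F t (N F).
  by rewrite big_distrr.
have halfG z : \sum_(0 <= t < z) 2^-1 * (gamma ^+ t * mean_form G t (N G))
    = 2^-1 * \sum_(0 <= t < z) gamma ^+ t * mean_form G t (N G).
  by rewrite big_distrr.
apply: (@nneseries_lt _ _ _ (2^-1 * (mean_form F 0 P + (1 - gamma)^-1 * (gamma * c)))
   C (2^-1 * (gamma * mean_form G 1 (E G)))).
- by move=> t; rewrite mulr_ge0 ?invr_ge0.
- by move=> t; rewrite mulr_ge0 ?invr_ge0.
- move=> T; rewrite half ler_wpM2l ?invr_ge0 //.
  apply: (@le_trans _ _ (mean_form F 0 P
     + \sum_(0 <= t < T) gamma ^+ t * (mean_form F t (E F) + gamma * c))).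
    by rewrite -total lerDl.
  rewrite lerD2l; under eq_bigr do rewrite EF add0r.
  rewrite -big_distrl ler_wpM2r ?mulr_ge0 //.
  rewrite big_mkord -[leRHS]mul1r ler_pdivlMr ?subr_gt0 // mulrC -[1 - gamma]opprB mulNr -subrX1.
  by rewrite opprB gerBl exprn_ge0.
- by rewrite !mulr_gt0 ?invr_gt0.
move=> T T1; rewrite half halfG [C * _]mulrCA -!mulrDr ler_wpM2l ?invr_ge0 //.
apply: (@le_trans _ _ (\sum_(0 <= t < T) gamma ^+ t * mean_form G t (N G)
   + gamma ^+ T * mean_form G T P)); last first.
  by rewrite lerD2l mulrCA ler_wpM2l ?exprn_ge0.
have pT := pge0 F T; have eqF := total F T; rewrite (total G T).
apply: (@le_trans _ _ (mean_form F 0 P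
   + \sum_(0 <= t < T) gamma ^+ t * (mean_form F t (E F) + gamma * c)
   + gamma * mean_form G 1 (E G))); first by rewrite -eqF lerD2r lerDl.
rewrite -addrA lerD2l.
have eqE K : \sum_(0 <= t < T) gamma ^+ t * (mean_form K t (E K) + gamma * c)
    = \sum_(0 <= t < T) gamma ^+ t * mean_form K t (E K)
      + \sum_(0 <= t < T) gamma ^+ t * (gamma * c).
  by rewrite -big_split; apply: eq_bigr => t _; rewrite mulrDr.
have zeroF : \sum_(0 <= t < T) gamma ^+ t * mean_form F t (E F) = 0.
  by apply: big1 => t _; rewrite EF mulr0.
rewrite !eqE zeroF add0r addrC lerD2r.
rewrite big_mkord (bigD1 (Ordinal T1)) //= expr1 lerDl.
by apply: sumr_ge0 => t _; rewrite mulr_ge0 ?exprn_ge0 // mean_form_ge0.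
Qed.

End Cost.

(** * A scalar system with a nonzero gain *)

Section ScalarExample.
Context {R : realType}.
Local Notation half := (2^-1%:M : 'M[R]_1).

Lemma half_eigenvalue z : complex_eigenvalue half z <-> z = real_complex R 2^-1.
Proof.
rewrite /complex_eigenvalue map_scalar_mx; split=> [/eigenvalueP[v]|->].
  rewrite mul_mx_scalar => /eqP; rewrite -subr_eq0 -scalerBl scaler_eq0 => /orP[|/eqP->].
    by rewrite subr_eq0 => /eqP.
  by rewrite eqxx.
apply/eigenvalueP; exists (1%:M); last by rewrite oner_neq0.
by rewrite mul_mx_scalar.
Qed.

(** The zero feedback already stabilizes, whatever the input matrix; hence
    detectability holds too, whatever the square root of [Q] is. *)
Lemma half_stabilizable (C : 'M[R]_1) : stabilizable half C.
Proof.
exists 0; rewrite mulmx0 addr0 => z /half_eigenvalue ->.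
by rewrite normc_real ger0_norm; lra.
Qed.

Lemma half_spectral_radius : spectral_radius half <= 2^-1.
Proof.
apply: ge_sup => [|_ [z /half_eigenvalue -> <-]].
  exists (ComplexField.Normc.normc (real_complex R 2^-1)), (real_complex R 2^-1) => //.
  exact/half_eigenvalue.
by rewrite normc_real ger0_norm //; lra.
Qed.

Lemma half_system : system_assumptions half (1%:M : 'M[R]_1) 1%:M 2^-1.
Proof.
split.
- exact: spd1.
- exact: half_stabilizable.
- by rewrite /detectable tr_scalar_mx; apply: half_stabilizable.
- exact: mxrank1.
- by apply/andP; split; lra.
Qed.

(** A zero gain would force [P *m A = 0] by [hess_greedy], hence [P = 0]. *)
Lemma half_gain_neq0 Sigma_w :
  gain half (1%:M : 'M[R]_1) 1%:M 2^-1 Otto Sigma_w 1 <> 0.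
Proof.
have sW := BTB_spd half_system; have [sP _] := riccati_spec half_system sW.
rewrite /gain /=; move: (riccati _ _ _ _ _) sP => P sP g0.
have g0' : 0 <= 2^-1 :> R by rewrite invr_ge0.
have sH := hess_spd (1%:M : 'M[R]_1) g0' sW (spd_psd sP).
have := hess_greedy half (spd_unit sH).
rewrite /greedy g0 mulmx0 trmx1 mul1mx mul_mx_scalar scalerA => /esym/eqP.
rewrite scaler_eq0 mulf_eq0 oppr_eq0 invr_eq0 pnatr_eq0 /= => /eqP P0.
have := sP.2 1%:M (oner_neq0 _).
by rewrite P0 quad0 ltxx.
Qed.

End ScalarExample.

Theorem corollary5p1 (R : realType) :
  (forall (n m : nat) (A : 'M[R]_n) (B : 'M[R]_(n, m)) (Q : 'M[R]_n)
      (gamma : R),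
    system_assumptions A B Q gamma ->
    [/\ (forall (o : geometry) (Sigma_w : 'M[R]_n) (lambda : R),
          spd Sigma_w -> 0 < lambda ->
          (exists! P : 'M[R]_n,
             spd P /\ dare A B Q gamma (control_weight B o Sigma_w lambda) P)
          /\
          (forall (d : measure_display) (Omega : measurableType d)
              (Pr : probability Omega R) (Sigma_0 : 'M[R]_n)
              (x0 : Omega -> 'cV[R]_n) (w : nat -> Omega -> 'cV[R]_n),
             psd Sigma_0 ->
             initial_and_noise Pr x0 w Sigma_0 Sigma_w ->
             unique_minimizer (cost Pr o lambda A B Q gamma Sigma_w x0 w)
               (gain A B Q gamma o Sigma_w lambda))),
        (forall (Sigma_w Sigma_w' : 'M[R]_n) (lambda lambda' : R),
          gain A B Q gamma Otto Sigma_w lambda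
          = gain A B Q gamma Otto Sigma_w' lambda'),
        (forall Sigma_w : 'M[R]_n,
          gain A B Q gamma KW rho%:M 1 @[rho --> 0^'+]
            --> gain A B Q gamma Otto Sigma_w 1),
        (`|gain A B Q gamma KW rho%:M 1 - gain A B Q gamma FR rho%:M 1|
            @[rho --> +oo] --> (0 : R))
      & (spectral_radius A < (Num.sqrt gamma)^-1 ->
          gain A B Q gamma FR rho%:M 1 @[rho --> 0^'+]
            --> (0 : 'M[R]_(m, n)))])
  /\
  (exists (n m : nat) (A : 'M[R]_n) (B : 'M[R]_(n, m)) (Q : 'M[R]_n)
      (gamma : R),
    [/\ system_assumptions A B Q gamma,
        spectral_radius A < (Num.sqrt gamma)^-1
      & forall Sigma_w : 'M[R]_n, gain A B Q gamma Otto Sigma_w 1 <> 0]).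
Proof.
split; last first.
  exists 1%N, 1%N, (2^-1%:M), 1%:M, 1%:M, 2^-1; split.
  - exact: half_system.
  - apply: le_lt_trans half_spectral_radius _.
    have s1 : Num.sqrt (2^-1 : R) < 1 by rewrite -[ltRHS]sqrtr1 ltr_sqrt //; lra.
    have s0 : 0 < Num.sqrt (2^-1 : R) by rewrite sqrtr_gt0; lra.
    apply: (@lt_trans _ _ 1); first by lra.
    by rewrite invf_gt1.
  - exact: half_gain_neq0.
move=> n m A B Q gamma sysA; split.
- move=> o Sigma_w lambda sSw l0; split.
    exact: riccati_exists_unique sysA _ (control_weight_spd o sysA sSw l0).
  by move=> d Omega Pr Sigma_0 x0 w sS0 law; apply: gain_unique_minimizer law.
- by [].
- by move=> Sigma_w; apply: gain_KW_cvg_Otto.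
- exact: gain_KW_FR_asymptotic.
- exact: gain_FR_cvg0.
Qed.
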